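(* Let $\Delta$ be an irreducible root system and $\mathcal A\subset\Delta^+$ its set of amazing roots. If $\gamma_1,\gamma_2\in\mathcal A$, then $\gamma_1\vee\gamma_2\in\mathcal A$.
   Context: Let $\Delta$ be an irreducible (reduced, crystallographic) root system, the root system of a simple complex Lie algebra, with positive roots $\Delta^+$, simple roots $\Pi$, and highest root $\theta$. $\Delta^+_l$ is the set of long positive roots (all roots are long in the simply-laced case). The partial order on $\Delta^+$: $\mu\preccurlyeq\nu$ if $\nu-\mu$ is a non-negative integral combination of simple roots. An upper ideal is a subset $I\subset\Delta^+$ such that $\nu\in I$, $\gamma\in\Delta^+$, $\nu\preccurlyeq\gamma$ imply $\gamma\in I$. An abelian ideal is an upper ideal $I$ with $\gamma'+\gamma''\notin\Delta^+$ for all $\gamma',\gamma''\in I$. For $\gamma\in\Delta^+$ put $I\langle\succcurlyeq\gamma\rangle=\{\nu\in\Delta^+\mid\nu\succcurlyeq\gamma\}$. It is known that for any $\mu_1,\mu_2\in\Delta^+$ there is a unique minimal root $\mu\in\Delta^+$ with $\mu\succcurlyeq\mu_1$ and $\mu\succcurlyeq\mu_2$; it is denoted $\mu_1\vee\mu_2$. Rootlets. Let $V$ be the real span of $\Delta$ and consider $V\oplus\mathbb R\delta$. The real affine roots are $\gamma+k\delta$ ($\gamma\in\Delta$, $k\in\mathbb Z$); the positive ones $\widehat\Delta^+$ are those with $k\ge 1$, or $k=0$ and $\gamma\in\Delta^+$. The affine Weyl group $\widehat W$ is generated by the reflections $s_{\gamma+k\delta}$, acting by $s_{\gamma+k\delta}(\beta+m\delta)=s_\gamma(\beta)+(m-k\langle\beta,\gamma^\vee\rangle)\delta$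 (so $\widehat W$ fixes $\delta$). For $w\in\widehat W$ let $N(w)=\{\nu\in\widehat\Delta^+\mid w(\nu)\in-\widehat\Delta^+\}$. It is known (Peterson) that for each abelian ideal $I$ there is a unique $w_I\in\widehat W$ with $N(w_I)=\{\delta-\gamma\mid\gamma\in I\}$. For a nonempty abelian ideal $I$, its rootlet is $\mathrm{rt}(I)=w_I(2\delta-\theta)$; it is known to be an element of $\Delta^+_l$, and every element of $\Delta^+_l$ is the rootlet of some nonempty abelian ideal. For $\mu\in\Delta^+_l$, the set of nonempty abelian ideals with rootlet $\mu$, ordered by inclusion, is known to have a unique maximal element, denoted $I(\mu)_{\max}$. A root $\gamma\in\Delta^+_l$ is amazing if $I(\gamma)_{\max}=I\langle\succcurlyeq\gamma\rangle$; $\mathcal A$ is the set of amazing roots. *)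

(* Defs.v *)
From HB Require Import structures.
From mathcomp Require Import all_boot all_order all_algebra.
From mathcomp Require Import boolp classical_sets reals.

Set Implicit Arguments.
Unset Strict Implicit.
Unset Printing Implicit Defensive.

Import Order.TTheory GRing.Theory Num.Theory.
Local Open Scope ring_scope.
Local Open Scope classical_set_scope.

(* Definite description: the only element of [P], with junk value [x0] when
   [P] is not a singleton. *)
Definition the (T : choiceType) (x0 : T) (P : set T) : T :=
  xget x0 [set x | P = [set x]].

Definition minimal_elements (T : Type) (le : T -> T -> Prop) (P : set T) :
  set T := [set x | P x /\ forall y, P y -> le y x -> y = x].

Definition maximal_elements (T : Type) (le : T -> T -> Prop) (P : set T) :
  set T := [set x | P x /\ forall y, P y -> le x y -> y = x].

Section RootSystem.
Variables (R : realType) (V : vectType R) (ip : {dot V for @idfun R}).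

(* <x, gamma^vee> *)
Definition cartan (x gamma : V) : R := 2 * ip x gamma / ip gamma gamma.

Definition refl (gamma x : V) : V := x - cartan x gamma *: gamma.

(* Reduced crystallographic root systems in the Euclidean space (V, ip); the
   sequence Delta only matters through its set of members. *)
Record is_root_system (Delta : seq V) : Prop := IsRootSystem {
  roots_span : <<Delta>>%VS = fullv;
  root_neq0 : 0 \notin Delta;
  roots_reduced : forall (gamma : V) (c : R),
    gamma \in Delta -> c *: gamma \in Delta -> c = 1 \/ c = -1;
  roots_refl : forall gamma beta,
    gamma \in Delta -> beta \in Delta -> refl gamma beta \in Delta;
  roots_integral : forall gamma beta,
    gamma \in Delta -> beta \in Delta ->
    exists k : int, cartan beta gamma = k%:~R }.

Definition irreducible (Delta : seq V) : Prop :=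
  (exists gamma, gamma \in Delta) /\
  forall A B : set V,
    [set` Delta] = A `|` B ->
    (forall a b, A a -> B b -> ip a b = 0) ->
    A = set0 \/ B = set0.

(* Non-negative integral combinations of Pi. *)
Definition nonneg_comb (Pi : seq V) : set V :=
  [set x | exists c : V -> nat, x = \sum_(a <- Pi) a *+ c a].

Record is_base (Delta Pi : seq V) : Prop := IsBase {
  base_root : {subset Pi <= Delta};
  base_basis : basis_of fullv Pi;
  base_sign : forall gamma, gamma \in Delta ->
    nonneg_comb Pi gamma \/ nonneg_comb Pi (- gamma) }.

Variables (Delta Pi : seq V).

Definition posroot : set V :=
  [set gamma | gamma \in Delta /\ nonneg_comb Pi gamma].

Definition long_posroot : set V :=
  [set gamma | posroot gamma /\
     forall beta, beta \in Delta -> ip beta beta <= ip gamma gamma].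

Definition root_le (mu nu : V) : Prop := nonneg_comb Pi (nu - mu).

Definition highest_root : V :=
  the 0 [set theta | posroot theta /\
                     forall gamma, posroot gamma -> root_le gamma theta].

Definition vee (mu1 mu2 : V) : V :=
  the 0 (minimal_elements root_le
           [set mu | [/\ posroot mu, root_le mu1 mu & root_le mu2 mu]]).

Definition upper_ideal (I : set V) : Prop :=
  I `<=` posroot /\
  forall nu gamma, I nu -> posroot gamma -> root_le nu gamma -> I gamma.

Definition abelian_ideal (I : set V) : Prop :=
  upper_ideal I /\
  forall gamma1 gamma2, I gamma1 -> I gamma2 -> ~ posroot (gamma1 + gamma2).

Definition ideal_ge (gamma : V) : set V :=
  [set nu | posroot nu /\ root_le gamma nu].

(* The vector x + t delta of V (+) R delta is the pair (x, t). *)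

Definition affine_posroot : set (V * R) :=
  [set x | exists (gamma : V) (k : int),
     [/\ x = (gamma, k%:~R), gamma \in Delta
       & 1 <= k \/ k = 0 /\ posroot gamma]].

Definition affine_refl (gamma : V) (k : int) (x : V * R) : V * R :=
  (refl gamma x.1, x.2 - k%:~R * cartan x.1 gamma).

(* Reflections being involutions, the group they generate is the monoid they
   generate. *)
Inductive affine_weyl : (V * R -> V * R) -> Prop :=
| affine_weyl_id : affine_weyl id
| affine_weyl_refl gamma k w :
    gamma \in Delta -> affine_weyl w ->
    affine_weyl (affine_refl gamma k \o w).

Definition inversions (w : V * R -> V * R) : set (V * R) :=
  [set nu | affine_posroot nu /\ affine_posroot (- w nu)].

Definition ideal_elt (I : set V) : V * R -> V * R :=
  @the (V * R -> V * R)%type id [set w | affine_weyl w /\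
                  inversions w = [set (- gamma, 1) | gamma in I]].

Definition rootlet (I : set V) : V * R := ideal_elt I (- highest_root, 2).

Definition ideals_with_rootlet (mu : V) : set (set V) :=
  [set I | [/\ abelian_ideal I, I !=set0 & rootlet I = (mu, 0)]].

Definition ideal_max (mu : V) : set V :=
  the set0 (maximal_elements subset (ideals_with_rootlet mu)).

Definition amazing : set V :=
  [set gamma | long_posroot gamma /\ ideal_max gamma = ideal_ge gamma].

End RootSystem.

(* Main.v *)
(* Write [rt I] for the rootlet of an abelian ideal [I] and [x >= y] for the root
   order.

   If [rt J = g] and [g' <= g] is a long root, then [g] is joined to [g'] by
   simple reflections lowering the root; at each step the affine root
   [w_J^-1 (a_i)] is forced to be [delta - nu] with [nu] positive, so [J] grows
   to an abelian ideal with rootlet [g'].  Conversely, rootlets decrease along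
   inclusions of abelian ideals.

   Let [g1], [g2] be amazing and [g] their join.  Then [g] is long, and
   [I = {>= g} = {>= g1} :&: {>= g2}] is abelian.  An ideal [J] with rootlet [g]
   grows to ideals with rootlets [g1] and [g2], hence lies in both [{>= g1}] and
   [{>= g2}], hence in [I].  Such a [J] exists (grow [{theta}], whose rootlet is
   [theta]), so [rt I <= rt J = g]; since [I] lies in [{>= g1}] and [{>= g2}],
   [rt I] dominates [g1] and [g2], hence [g].  So [rt I = g], and [I] is the
   largest ideal with this rootlet. *)
Require Import Defs.
From mathcomp Require Import all_boot all_order all_algebra.
From mathcomp Require Import boolp classical_sets reals.
From mathcomp Require Import lra ring zify.

Set Implicit Arguments.
Unset Strict Implicit.
Unset Printing Implicit Defensive.

Import Order.TTheory GRing.Theory Num.Theory.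
Local Open Scope ring_scope.
Local Open Scope classical_set_scope.

(** The delicate point is that the join is long. A positive root is long exactly when each of its
    coefficients satisfies an integrality condition of its own ([longlat]), so a coefficientwise
    maximum of long roots is long as soon as it is a root; and it is a root when the two roots
    dominate a common positive root. Since g1 and g2 may have disjoint supports, g2 is first raised
    to a maximal long root below the join, and norm computations, in place of a classification, show
    that this root shares a long simple root with g1. The same integrality keeps the descent from g
    to g' from overshooting g'.

    The rootlet is read off a definite description, so each use must identify the described element.
    Uniqueness follows from the exchange property. *)

Lemma int_gt0_ge1 (R : archiRealDomainType) (x : R) :
  x \is a Num.int -> 0 < x -> 1 <= x.
Proof.
by move=> xZ x0; rewrite -(gtr0_norm x0) norm_intr_ge1 // gt_eqF.
Qed.

Lemma int_gt1_ge2 (R : archiRealDomainType) (x : R) :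
  x \is a Num.int -> 1 < x -> 2 <= x.
Proof.
move=> xZ x1; suff: 1 <= x - 1 by lra.
by apply: int_gt0_ge1; [rewrite rpredB ?rpred1 | lra].
Qed.

(** * Roots and the root order *)

Section Roots.
Variables (R : realType) (V : vectType R) (ip : {dot V for @idfun R}).
Variables (Delta Pi : seq V).
Hypothesis rootsD : is_root_system ip Delta.
Hypothesis baseP : is_base Delta Pi.

Lemma ipDl x y z : ip (x + y) z = ip x z + ip y z.
Proof. exact: linearDl. Qed.
Lemma ipDr x y z : ip z (x + y) = ip z x + ip z y.
Proof. exact: linearDr. Qed.
Lemma ipNl x z : ip (- x) z = - ip x z.
Proof. exact: linearNl. Qed.
Lemma ipNr x z : ip z (- x) = - ip z x.
Proof. exact: linearNr. Qed.
Lemma ipZl a x z : ip (a *: x) z = a * ip x z.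
Proof. exact: linearZl_LR. Qed.
Lemma ipZr a x z : ip z (a *: x) = a * ip z x.
Proof. exact: (linearZr_LR ip). Qed.
Lemma ip0l z : ip 0 z = 0. Proof. exact: linear0l. Qed.
Lemma ip0r z : ip z 0 = 0. Proof. exact: linear0r. Qed.
Definition ipE := (ipDl, ipDr, ipNl, ipNr, ipZl, ipZr, ip0l, ip0r).

Lemma ipC x y : ip x y = ip y x.
Proof. by rewrite (hermitian_subproof x y) expr0 mul1r. Qed.

Lemma ip_gt0 x : x != 0 -> 0 < ip x x.
Proof. exact: neq0_dnorm_gt0. Qed.

Lemma ip_ge0 x : 0 <= ip x x.
Proof. by have [->|/ip_gt0/ltW//] := eqVneq x 0; rewrite ip0l. Qed.

Lemma ip_le0_eq0 x : ip x x <= 0 -> x = 0.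
Proof. by move=> x0; apply/eqP/negPn/negP => /ip_gt0; rewrite ltNge x0. Qed.

Lemma ip_suml (I : finType) (F : I -> V) y :
  ip (\sum_i F i) y = \sum_i ip (F i) y.
Proof. exact: linear_sumlz. Qed.

Lemma root_nz x : x \in Delta -> x != 0.
Proof. by move=> xD; apply: contraNneq (root_neq0 rootsD) => <-. Qed.

Lemma root_ip x : x \in Delta -> 0 < ip x x.
Proof. by move/root_nz/ip_gt0. Qed.

Lemma refl_root x y : x \in Delta -> y \in Delta -> refl ip x y \in Delta.
Proof. exact: roots_refl. Qed.

Lemma cartan_int x y : x \in Delta -> y \in Delta -> cartan ip y x \is a Num.int.
Proof. by move=> xD yD; have [k ->] := roots_integral rootsD xD yD; exact: intr_int. Qed.

Lemma cartan_ip x y : x \in Delta -> cartan ip y x * ip x x = 2 * ip y x.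
Proof. by move=> /root_ip x0; rewrite /cartan; field; rewrite gt_eqF. Qed.

Lemma cartan_self x : x \in Delta -> cartan ip x x = 2.
Proof. by move=> /root_ip x0; rewrite /cartan; field; rewrite gt_eqF. Qed.

Lemma cartan_gt0 x y : x \in Delta -> (0 < cartan ip y x) = (0 < ip y x).
Proof.
move=> /root_ip x0; rewrite /cartan pmulr_lgt0 ?invr_gt0 // pmulr_rgt0 //.
Qed.

Lemma cartanNr x y : cartan ip y (- x) = - cartan ip y x.
Proof. by rewrite /cartan !ipE opprK mulrN mulNr. Qed.

Lemma reflN x y : refl ip (- x) y = refl ip x y.
Proof. by rewrite /refl cartanNr scalerN scaleNr opprK. Qed.

Lemma root_opp x : x \in Delta -> - x \in Delta.
Proof.
move=> xD; have := refl_root xD xD; rewrite /refl cartan_self // scaler_nat.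
by rewrite mulr2n opprD addrA subrr add0r.
Qed.

Lemma root_oppE x : (- x \in Delta) = (x \in Delta).
Proof. by apply/idP/idP => /root_opp; rewrite ?opprK. Qed.

Lemma reflK x : x \in Delta -> involutive (refl ip x).
Proof.
move=> xD y; rewrite {1}/refl [cartan ip (refl _ _ _) x]/cartan /refl !ipE.
rewrite -[X in _ - X = _]/((_ : R) *: x) -addrA -opprD -scalerDl.
rewrite [X in X *: x](_ : _ = 0) ?scale0r ?subr0 // /cartan.
by have := root_ip xD => x0; field; rewrite gt_eqF.
Qed.

Lemma refl_ip x y z : x \in Delta -> ip (refl ip x y) (refl ip x z) = ip y z.
Proof.
move=> /root_ip x0; rewrite /refl /cartan !ipE (ipC x z).
by field; rewrite gt_eqF.
Qed.

Lemma root_ip_lt x y : x \in Delta -> y \in Delta -> x != y ->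
  2 * ip x y < ip x x + ip y y.
Proof.
move=> xD yD xy; have: 0 < ip (x - y) (x - y) by rewrite ip_gt0 // subr_eq0.
by rewrite !ipE (ipC y x); lra.
Qed.

(** By [root_ip_lt], twice the inner product stays strictly below twice the norm of the longer root
    [x], so this positive integer is less than 2. *)
Lemma cartan_eq1 x y : x \in Delta -> y \in Delta -> x != y ->
  ip y y <= ip x x -> 0 < ip y x -> cartan ip y x = 1.
Proof.
move=> xD yD xy yx y0; have x0 := root_ip xD.
have cZ := cartan_int xD yD; have cE := cartan_ip y xD.
have c0 : 0 < cartan ip y x by rewrite cartan_gt0.
have c1 := int_gt0_ge1 cZ c0.
apply/eqP; rewrite eq_le c1 andbT leNgt; apply/negP => /(int_gt1_ge2 cZ) c2.
by have := root_ip_lt xD yD xy; rewrite (ipC x y); nra.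
Qed.

Lemma root_sub x y : x \in Delta -> y \in Delta -> x != y -> 0 < ip x y ->
  x - y \in Delta.
Proof.
move=> xD yD xy xy0; have [yx|/ltW yx] := leP (ip x x) (ip y y).
  have := refl_root yD xD; rewrite /refl cartan_eq1 ?scale1r // eq_sym //.
rewrite -root_oppE opprB; have := refl_root xD yD.
by rewrite /refl cartan_eq1 ?scale1r // ipC.
Qed.

Lemma root_add x y : x \in Delta -> y \in Delta -> x != - y -> ip x y < 0 ->
  x + y \in Delta.
Proof.
move=> xD yD xy xy0; rewrite -[y]opprK root_sub ?root_opp //.
by rewrite ipNr oppr_gt0.
Qed.

(** * Coordinates in the base *)

Notation n := (size Pi).
Definition sroot (i : 'I_n) : V := Pi`_i.
Definition coef (i : 'I_n) (x : V) : R := coord (in_tuple Pi) i x.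

Lemma coefD i x y : coef i (x + y) = coef i x + coef i y.
Proof. exact: linearD. Qed.
Lemma coefN i x : coef i (- x) = - coef i x.
Proof. exact: linearN. Qed.
Lemma coefZ i a x : coef i (a *: x) = a * coef i x.
Proof. exact: linearZ. Qed.
Lemma coef0 i : coef i 0 = 0.
Proof. exact: linear0. Qed.
Definition coefE := (coefD, coefN, coefZ, coef0).

Lemma coef_sroot i j : coef i (sroot j) = (i == j)%:R.
Proof.
rewrite /coef /sroot -(tnth_nth 0 (in_tuple Pi)) (tnth_nth 0).
rewrite coord_free; last exact: basis_free (base_basis baseP).
by rewrite eq_sym.
Qed.

Lemma coef_sroot1 i : coef i (sroot i) = 1.
Proof. by rewrite coef_sroot eqxx. Qed.

Lemma coef_sum x : x = \sum_i coef i x *: sroot i.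
Proof.
rewrite {1}(coord_basis (X := in_tuple Pi) (base_basis baseP) (memvf x)).
by apply: eq_bigr => i _.
Qed.

Lemma coef_inj x y : (forall i, coef i x = coef i y) -> x = y.
Proof.
by move=> xy; rewrite (coef_sum x) (coef_sum y); apply: eq_bigr => i _; rewrite xy.
Qed.

Lemma ip_coef x y : ip x y = \sum_i coef i x * ip (sroot i) y.
Proof.
by rewrite {1}(coef_sum x) ip_suml; apply: eq_bigr => i _; rewrite ipZl.
Qed.

Lemma sroot_root i : sroot i \in Delta.
Proof. by apply: (base_root baseP); rewrite mem_nth. Qed.

(** Integrality is left out so that the comparison makes sense on all of [V]; on the root lattice
    [root_leE] restores it. *)
Definition rle x y := forall i, coef i x <= coef i y.
Definition qlat x := forall i, coef i x \is a Num.int.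

Lemma rlexx x : rle x x. Proof. by move=> i. Qed.
Lemma rle_trans y x z : rle x y -> rle y z -> rle x z.
Proof. by move=> xy yz i; exact: le_trans (xy i) (yz i). Qed.
Lemma rle_anti x y : rle x y -> rle y x -> x = y.
Proof. by move=> xy yx; apply: coef_inj => i; apply/eqP; rewrite eq_le xy yx. Qed.

Lemma nonneg_combP x :
  nonneg_comb Pi x <-> forall i, coef i x \is a Num.nat.
Proof.
have uPi : uniq Pi := free_uniq (basis_free (base_basis baseP)).
split=> [[c ->] i|xN].
  rewrite (big_nth 0) big_mkord.
  have -> : \sum_(j < n) Pi`_j *+ c Pi`_j = \sum_(j < n) (c (sroot j))%:R *: sroot j.
    by apply: eq_bigr => j _; rewrite scaler_nat.
  rewrite /coef linear_sum /= (bigD1 i) //= big1 => [|j ji].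
    by rewrite addr0 -/(coef _ _) coefZ coef_sroot eqxx mulr1 natr_nat.
  by rewrite -/(coef _ _) coefZ coef_sroot eq_sym (negPf ji) mulr0.
(* [nonneg_comb] indexes coefficients by vectors; as [Pi] has no repetition, this sum has a single
   term at each simple root. *)
exists (fun v => \sum_(i | sroot i == v) Num.truncn (coef i x))%N.
rewrite {1}(coef_sum x) (big_nth 0) big_mkord; apply: eq_bigr => i _.
rewrite (big_pred1 i) => [|j] /=; last first.
  by rewrite /sroot nth_uniq.
by have := xN i; rewrite natrEtruncn => /eqP {1}<-; rewrite scaler_nat.
Qed.

Lemma root_sign x : x \in Delta ->
  (forall i, coef i x \is a Num.nat) \/ (forall i, - coef i x \is a Num.nat).
Proof.
move=> /(base_sign baseP)[|] /nonneg_combP xN; first by left.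
by right=> i; rewrite -coefN.
Qed.

Lemma root_qlat x : x \in Delta -> qlat x.
Proof.
by move=> /root_sign[|] xN i; [exact: intr_nat | rewrite -rpredN intr_nat].
Qed.

Definition pos x := x \in Delta /\ forall i, 0 <= coef i x.

Lemma posrootE x : posroot Delta Pi x <-> pos x.
Proof.
split=> [[xD /nonneg_combP xN]|[xD x0]]; split=> //.
  by move=> i; apply: natr_ge0.
by apply/nonneg_combP => i; rewrite -intrEge0 ?root_qlat.
Qed.

Lemma root_leE x y : qlat x -> qlat y -> root_le Pi x y <-> rle x y.
Proof.
move=> xZ yZ; rewrite /root_le nonneg_combP; split=> h i; have := h i.
  by move=> /natr_ge0; rewrite !coefE subr_ge0.
by move=> xy; rewrite -intrEge0 ?coefE ?rpredB // subr_ge0.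
Qed.

Lemma sroot_pos i : pos (sroot i).
Proof. by split=> [|j]; rewrite ?sroot_root // coef_sroot ler0n. Qed.

Lemma pos_root x : pos x -> x \in Delta. Proof. by case. Qed.

Lemma root_pos i x : x \in Delta -> 0 < coef i x -> pos x.
Proof.
move=> xD xi; split=> // j; have [/(_ j)/natr_ge0//|/(_ i)/natr_ge0] := root_sign xD.
by rewrite oppr_ge0 leNgt xi.
Qed.

Lemma root_posVneg x : x \in Delta -> pos x \/ pos (- x).
Proof.
move=> xD; have [xN|xN] := root_sign xD; [left|right]; split; rewrite ?root_opp // => i.
  exact: natr_ge0.
by rewrite coefN natr_ge0.
Qed.

Lemma pos_ex x : pos x -> exists i, 0 < coef i x.
Proof.
move=> [xD x0]; apply: contrapT => nx; have /negP := root_nz xD; apply.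
apply/eqP/coef_inj => i; rewrite coef0; apply/eqP; rewrite eq_le x0 andbT leNgt.
by apply/negP => xi; apply: nx; exists i.
Qed.

Lemma posN x : pos x -> ~ pos (- x).
Proof.
move=> /pos_ex[i xi] [_ /(_ i)]; rewrite coefN; lra.
Qed.

Lemma pos_coef_ge1 x i : pos x -> 0 < coef i x -> 1 <= coef i x.
Proof. by move=> [/root_qlat xZ _]; exact: int_gt0_ge1. Qed.

Lemma qlat_step x y i : qlat x -> qlat y -> coef i x < coef i y ->
  coef i x + 1 <= coef i y.
Proof.
move=> xZ yZ xy; suff: 1 <= coef i y - coef i x by lra.
by apply: int_gt0_ge1; [rewrite rpredB | lra].
Qed.

Lemma scalar_sroot x i : x \in Delta -> (forall j, j != i -> coef j x = 0) ->
  x = sroot i \/ x = - sroot i.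
Proof.
move=> xD x0; have xE : x = coef i x *: sroot i.
  apply: coef_inj => j; rewrite coefZ coef_sroot.
  by have [->|/x0->] := eqVneq j i; rewrite ?mulr1 ?mulr0.
have := roots_reduced rootsD (sroot_root i) (c := coef i x).
rewrite -xE => /(_ xD)[] c; rewrite xE c ?scale1r ?scaleN1r; tauto.
Qed.

Lemma pos_neq_sroot x i : pos x -> x != sroot i ->
  exists2 j, j != i & 0 < coef j x.
Proof.
move=> xP xi; apply: contrapT => nx.
have x0 j : j != i -> coef j x = 0.
  move=> ji; apply/eqP; rewrite eq_le (xP.2 j) andbT leNgt; apply/negP => xj.
  by apply: nx; exists j.
have [xE|xE] := scalar_sroot xP.1 x0; first by rewrite xE eqxx in xi.
by apply: (posN (sroot_pos i)); rewrite -xE.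
Qed.

(** Some coefficient away from [i] is positive and is left unchanged, and one positive coefficient
    makes a root positive. *)
Lemma pos_shift x i c : pos x -> x != sroot i -> x + c *: sroot i \in Delta ->
  pos (x + c *: sroot i).
Proof.
move=> xP xi xD; have [j ji xj] := pos_neq_sroot xP xi.
by apply: (root_pos (i := j)) => //; rewrite !coefE coef_sroot (negPf ji) mulr0 addr0.
Qed.

Lemma refl_sroot_pos x i : pos x -> x != sroot i -> pos (refl ip (sroot i) x).
Proof.
move=> xP xi; rewrite /refl -scaleNr; apply: pos_shift => //.
by rewrite scaleNr; apply: refl_root xP.1; exact: sroot_root.
Qed.

Lemma pos_subs x i : pos x -> x - sroot i \in Delta -> pos (x - sroot i).
Proof.
move=> xP xD; rewrite -scaleN1r; apply: pos_shift; rewrite ?scaleN1r //.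
by apply: contraTneq xD => ->; rewrite subrr (root_neq0 rootsD).
Qed.

Lemma pos_add x y : pos x -> pos y -> x + y \in Delta -> pos (x + y).
Proof. by move=> [_ x0] [_ y0] xyD; split=> // i; rewrite coefD addr_ge0. Qed.

Lemma sroot_diff i j : sroot i - sroot j \notin Delta.
Proof.
have [->|ij] := eqVneq i j; first by rewrite subrr (root_neq0 rootsD).
apply/negP => D; have [/posN|[_ /(_ i)]] := root_posVneg D.
  apply; apply: (root_pos (i := j)); rewrite ?root_opp // !coefE !coef_sroot eqxx.
  by rewrite eq_sym (negPf ij) sub0r opprK ltr01.
by rewrite !coefE !coef_sroot eqxx (negPf ij) subr0 oppr_ge0 ler10.
Qed.

Lemma sroot_inj : injective sroot.
Proof.
move=> i j /(congr1 (coef i)); rewrite !coef_sroot eqxx.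
by case: eqVneq => // _ /eqP; rewrite oner_eq0.
Qed.

Lemma sroot_ip_le0 i j : i != j -> ip (sroot i) (sroot j) <= 0.
Proof.
move=> ij; rewrite leNgt; apply/negP => ij0; have /negP := sroot_diff i j; apply.
by rewrite root_sub ?sroot_root // (inj_eq sroot_inj).
Qed.

Lemma ip_pos_coef x y : 0 < ip x y -> exists i, 0 < coef i x * ip (sroot i) y.
Proof.
move=> xy; apply: contrapT => nx; suff: ip x y <= 0 by rewrite leNgt xy.
rewrite ip_coef sumr_le0 // => i _; rewrite leNgt; apply/negP => h.
by apply: nx; exists i.
Qed.

Lemma rle_pos_coef x y : rle 0 x -> 0 < ip x y ->
  exists i, 0 < coef i x /\ 0 < ip (sroot i) y.
Proof.
move=> x0 /ip_pos_coef[i xi]; exists i; have := x0 i; rewrite coef0 => xi0.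
have xiP : 0 < coef i x by rewrite lt_neqAle xi0 andbT; apply: contraTneq xi => <-; rewrite mul0r ltxx.
by split=> //; rewrite -(pmulr_rgt0 _ xiP).
Qed.

Lemma rle_pos_neq x y : rle x y -> x <> y ->
  exists i, coef i x < coef i y /\ 0 < ip (sroot i) (y - x).
Proof.
move=> xy nxy; have [||i] := @rle_pos_coef (y - x) (y - x).
- by move=> i; rewrite !coefE subr_ge0.
- by rewrite ip_gt0 // subr_eq0; apply/eqP => yx; exact: nxy.
by rewrite !coefE subr_gt0; exists i.
Qed.

(** * Heights and chains of roots *)

Definition ht x : R := \sum_i coef i x.

Lemma htD x y : ht (x + y) = ht x + ht y.
Proof. by rewrite /ht -big_split; apply: eq_bigr => i _; rewrite coefD. Qed.
Lemma htZ a x : ht (a *: x) = a * ht x.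
Proof. by rewrite /ht mulr_sumr; apply: eq_bigr => i _; rewrite coefZ. Qed.
Lemma htN x : ht (- x) = - ht x.
Proof. by rewrite -scaleN1r htZ mulN1r. Qed.
Lemma ht_sroot i : ht (sroot i) = 1.
Proof.
rewrite /ht (bigD1 i) //= big1 => [|j ji]; rewrite coef_sroot ?eqxx ?addr0 //.
by rewrite (negPf ji).
Qed.
Definition htE := (htD, htZ, htN, ht_sroot).

Lemma ht_int x : qlat x -> ht x \is a Num.int.
Proof. by move=> xZ; apply: rpred_sum. Qed.

Lemma ht_le x y : rle x y -> ht x <= ht y.
Proof. by move=> xy; apply: ler_sum => i _; exact: xy. Qed.

Lemma ht_lt x y : rle x y -> x <> y -> ht x < ht y.
Proof.
move=> xy nxy; rewrite lt_neqAle ht_le // andbT; apply/eqP => h; apply: nxy.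
apply: rle_anti => // i; suff /eqP : \sum_i (coef i y - coef i x) = 0.
  rewrite psumr_eq0 => [/allP/(_ i (mem_index_enum i))|j _]; rewrite ?subr_ge0 //.
  by rewrite subr_eq0 => /eqP ->.
by rewrite sumrB -/(ht _) -/(ht _) h subrr.
Qed.

(** Heights are real numbers here; a measure that stays nonnegative and drops by at least one is
    still well founded. *)
Lemma real_ind (T : Type) (m : T -> R) (P : T -> Prop) :
  (forall x, (forall y, 0 <= m y -> m y + 1 <= m x -> P y) -> P x) ->
  forall x, P x.
Proof.
move=> IH; suff H k : forall x, m x < k%:R -> P x.
  move=> x; apply: (H (Num.truncn (m x)).+1); exact: truncnS_gt.
elim: k => [|k IHk] x xk; apply: IH => y y0 yx.
  by exfalso; move: xk yx; lra.
apply: IHk; move: xk; rewrite -natr1; lra.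
Qed.

#[local] Hint Resolve sroot_root sroot_pos : core.
#[local] Hint Extern 0 (is_true (_ \in Delta)) => (apply: pos_root; eassumption) : core.

Lemma pos_qlat x : pos x -> qlat x.
Proof. by case=> /root_qlat. Qed.

Lemma pos_nz x : pos x -> x != 0.
Proof. by move=> [/(root_nz)]. Qed.

Lemma pos_neqN x y : pos x -> pos y -> x != - y.
Proof. by move=> xP yP; apply/eqP => xy; apply: (posN yP); rewrite -xy. Qed.

Lemma pos_ge0 x i : pos x -> 0 <= coef i x. Proof. by case. Qed.

Lemma rle_addr x i : rle x (x + sroot i).
Proof. by move=> k; rewrite coefE coef_sroot lerDl ler0n. Qed.

Lemma rle_step x y i : pos x -> pos y -> rle x y -> coef i x < coef i y ->
  rle (x + sroot i) y.
Proof.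
move=> xP yP xy xyi k; rewrite coefE coef_sroot; have [->|_] := eqVneq k i.
  by apply: qlat_step => //; exact: pos_qlat.
by rewrite addr0.
Qed.

Lemma rle_subr x y i : rle (x + sroot i) y <-> rle x (y - sroot i).
Proof. by split=> h k; have := h k; rewrite !coefE; lra. Qed.

Lemma rle_sroot_eq x i : pos x -> rle x (sroot i) -> x = sroot i.
Proof.
move=> xP xi; have [//|nxi] := eqVneq x (sroot i).
have [j ji] := pos_neq_sroot xP nxi.
by have := xi j; rewrite coef_sroot (negPf ji) leNgt => /negP.
Qed.

Lemma pos_addr x i : pos x -> x + sroot i \in Delta -> pos (x + sroot i).
Proof. by move=> xP; apply: pos_add. Qed.

(** Some simple root in the support of [y - x] pairs positively with [y - x]. It therefore pairs
    negatively with [x] and can be added there, or positively with [y] and can be subtracted; the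
    second case shortens the interval from above. *)
Lemma chain_up x y : pos x -> pos y -> rle x y -> x <> y ->
  exists i, x + sroot i \in Delta /\ rle (x + sroot i) y.
Proof.
move=> xP; elim/(@real_ind _ (fun y => ht y - ht x)): y => y IH yP xy nxy.
have [i [xyi]] := rle_pos_neq xy nxy.
rewrite !ipE => d; have [xi|xi] := ltP (ip x (sroot i)) 0.
  exists i; split; last exact: rle_step.
  by apply: root_add => //; exact: pos_neqN.
have yi : y != sroot i.
  by apply/eqP => yE; apply: nxy; rewrite yE; apply: rle_sroot_eq; rewrite -?yE.
have yD : y - sroot i \in Delta.
  by apply: root_sub => //; rewrite ipC; move: xi d; rewrite ipC; lra.
have xy' : rle x (y - sroot i) by apply/rle_subr/rle_step.
have [xE|/eqP nx] := eqVneq x (y - sroot i).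
  by exists i; rewrite xE subrK; split.
have [|||||j [jD jle]] // := IH (y - sroot i).
- by rewrite subr_ge0 ht_le.
- by rewrite !htE; lra.
- exact: pos_subs.
exists j; split=> //; apply: rle_trans jle _.
by rewrite -{2}(subrK (sroot i) y); exact: rle_addr.
Qed.

Lemma chain_down x y : pos x -> pos y -> rle x y -> x <> y ->
  exists i, y - sroot i \in Delta /\ rle x (y - sroot i).
Proof.
move=> + yP; elim/(@real_ind _ (fun x => ht y - ht x)): x => x IH xP xy nxy.
have [i [xiD xiy]] := chain_up xP yP xy nxy.
have [yE|/eqP nx] := eqVneq (x + sroot i) y.
  by exists i; rewrite -yE addrK; split.
have [|||||j [jD jle]] // := IH (x + sroot i).
- by rewrite subr_ge0 ht_le.
- by rewrite !htE; lra.
- exact: pos_addr.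
by exists j; split=> //; apply: rle_trans jle; exact: rle_addr.
Qed.

(* Otherwise [x - a_i] and [x - a_j] would have a positive inner product,
   making [a_j - a_i] a root. *)
Lemma root_sub2 x i j : x \in Delta -> i != j ->
  x - sroot i \in Delta -> x - sroot j \in Delta -> x <> sroot i + sroot j ->
  x - sroot i - sroot j \in Delta.
Proof.
move=> xD ij xi xj nx; apply: contraT => nD; exfalso.
have ij0 := sroot_ip_le0 ij; have x0 := root_ip xD.
have ip1 : ip (x - sroot i) (sroot j) <= 0.
  rewrite leNgt; apply: contraNN nD => h; apply: root_sub => //.
  by apply/eqP => e; apply: nx; rewrite -e addrC subrK.
have ip2 : ip (x - sroot j) (sroot i) <= 0.
  rewrite leNgt; apply: contraNN nD => h; rewrite addrAC; apply: root_sub => //.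
  by apply/eqP => e; apply: nx; rewrite -e subrK.
have /negP := sroot_diff j i; apply.
have -> : sroot j - sroot i = (x - sroot i) - (x - sroot j).
  by rewrite opprB [RHS]addrC addrA subrK.
apply: root_sub => //; last first.
  by move: ip1 ip2; rewrite !ipE (ipC (sroot j) (sroot i)) (ipC (sroot i) x); lra.
by rewrite (inj_eq (addrI x)) eqr_opp (inj_eq (sroot_inj)).
Qed.

Lemma root_add2 x i j : x \in Delta -> i != j ->
  x + sroot i \in Delta -> x + sroot j \in Delta ->
  x <> - (sroot i + sroot j) -> x + sroot i + sroot j \in Delta.
Proof.
move=> xD ij xi xj nx; rewrite -root_oppE // !opprD.
apply: root_sub2; rewrite -?opprD ?root_oppE //.
by move=> e; apply: nx; rewrite -e opprK.
Qed.

(** * Joins of positive roots *)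

Variable theta : V.
Hypothesis thetaP : pos theta.
Hypothesis theta_max : forall x, pos x -> rle x theta.

(* If [x - a_i] and [x - a_j] lie above both [g1] and [g2], then so does
   [x - a_i - a_j]; hence descents from [theta] all end at the same root. *)
Lemma join_ex g1 g2 : pos g1 -> pos g2 ->
  exists nu, [/\ pos nu, rle g1 nu, rle g2 nu &
    forall x, pos x -> rle g1 x -> rle g2 x -> rle nu x].
Proof.
move=> g1P g2P; pose S x := [/\ pos x, rle g1 x & rle g2 x].
suff H x : S x -> exists nu, [/\ S nu, rle nu x &
    forall y, S y -> rle y x -> rle nu y].
  have [|nu [[nuP nu1 nu2] _ nu_min]] := H theta.
    by split=> //; exact: theta_max.
  by exists nu; split=> // x xP x1 x2; apply: nu_min; [split|exact: theta_max].
elim/(@real_ind _ ht): x => x IH xS; have [xP x1 x2] := xS.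
have htP y : S y -> 0 <= ht y by move=> [yP _ _]; apply: sumr_ge0 => i _; exact: pos_ge0.
have [[i iS]|nS] := pselect (exists i, S (x - sroot i)); last first.
  exists x; split=> // y yS yx; have [->|/eqP nyx] := eqVneq y x; first exact: rlexx.
  have [yP y1 y2] := yS; have [i [iD iy]] := chain_down yP xP yx nyx.
  exfalso; apply: nS; exists i; split.
  - exact: pos_subs.
  - exact: rle_trans y1 iy.
  - exact: rle_trans y2 iy.
have IHs k : S (x - sroot k) -> exists nu, [/\ S nu, rle nu (x - sroot k) &
    forall y, S y -> rle y (x - sroot k) -> rle nu y].
  by move=> kS; apply: IH => //; [exact: htP|rewrite !htE; lra].
have subr_le k : rle (x - sroot k) x.
  by rewrite -{2}(subrK (sroot k) x); exact: rle_addr.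
have [nu [nuS nux nu_min]] := IHs i iS.
exists nu; split=> // [|y yS yx]; first exact: rle_trans nux (subr_le i).
have [->|/eqP nyx] := eqVneq y x; first exact: rle_trans nux (subr_le i).
have [yP y1 y2] := yS; have [j [jD jy]] := chain_down yP xP yx nyx.
have [ij|ij] := eqVneq i j; first by apply: nu_min => //; rewrite ij.
have jS : S (x - sroot j).
  by split; [exact: pos_subs|exact: rle_trans y1 jy|exact: rle_trans y2 jy].
have [mu [muS mux mu_min]] := IHs j jS.
have [iP i1 i2] := iS; have [jP j1 j2] := jS.
have zS : S (x - sroot i - sroot j).
  have le_z g : rle g (x - sroot i) -> rle g (x - sroot j) ->
      rle g (x - sroot i - sroot j).
    move=> gi gj k; have := gi k; have := gj k; rewrite !coefE !coef_sroot.
    by have [->|_] := eqVneq k i; [rewrite (negPf ij)|]; rewrite ?subr0.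
  have zD : x - sroot i - sroot j \in Delta.
    (* In the excluded case [g1] lies below both [x - sroot j = sroot i] and
       [x - sroot i = sroot j], which is impossible for a positive root. *)
    apply: root_sub2 => // xE.
    have g1i : g1 = sroot i by apply: rle_sroot_eq => //; move: j1; rewrite xE addrK.
    have := i1 i; rewrite g1i xE addrAC subrr add0r !coef_sroot eqxx (negPf ij).
    by rewrite ler10.
  by split; [exact: pos_subs|exact: le_z|exact: le_z].
have zi : rle (x - sroot i - sroot j) (x - sroot i).
  by move=> k; rewrite [leLHS]coefD gerDl coefN coef_sroot oppr_le0 ler0n.
have zj : rle (x - sroot i - sroot j) (x - sroot j).
  by rewrite addrAC => k; rewrite [leLHS]coefD gerDl coefN coef_sroot oppr_le0 ler0n.
apply: rle_trans (mu_min y yS jy); apply: nu_min => //.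
by apply: rle_trans zi; apply: mu_min.
Qed.

(** * Coefficientwise maxima of roots *)

Definition vmax x y := \sum_i Num.max (coef i x) (coef i y) *: sroot i.

Lemma coef_vmax i x y : coef i (vmax x y) = Num.max (coef i x) (coef i y).
Proof.
rewrite /vmax {1}/coef linear_sum (bigD1 i) //= big1 => [|j ji].
  by rewrite -/(coef _ _) !coefE coef_sroot eqxx mulr1 addr0.
by rewrite -/(coef _ _) !coefE coef_sroot eq_sym (negPf ji) mulr0.
Qed.

Lemma vmax_r x y : rle x y -> vmax x y = y.
Proof. by move=> xy; apply: coef_inj => i; rewrite coef_vmax max_r. Qed.
Lemma vmaxC x y : vmax x y = vmax y x.
Proof. by apply: coef_inj => i; rewrite !coef_vmax maxC. Qed.
Lemma rle_vmaxl x y : rle x (vmax x y).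
Proof. by move=> i; rewrite coef_vmax le_max lexx. Qed.
Lemma rle_vmaxr x y : rle y (vmax x y).
Proof. by move=> i; rewrite coef_vmax le_max lexx orbT. Qed.
Lemma vmax_rle x y z : rle x z -> rle y z -> rle (vmax x y) z.
Proof. by move=> xz yz i; rewrite coef_vmax ge_max xz yz. Qed.

(** Induction on the total height of [x] and [y] over the common lower bound [r]. If the first steps
    from [r] to [x] and to [y] agree, [r] is raised. If not, both steps together give a root [z],
    and [vmax x y] is the maximum of [vmax x z] and [vmax y z], which dominate [z]. *)
Lemma vmax_pos r x y : pos r -> pos x -> pos y -> rle r x -> rle r y ->
  pos (vmax x y).
Proof.
pose m (t : V * V * V) := ht t.1.2 + ht t.2 - 2 * ht t.1.1.
move: r x y; suff H (t : V * V * V) : pos t.1.1 -> pos t.1.2 -> pos t.2 ->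
    rle t.1.1 t.1.2 -> rle t.1.1 t.2 -> pos (vmax t.1.2 t.2).
  by move=> r x y; exact: (H (r, x, y)).
elim/(@real_ind _ m): t => -[[r x] y] /= IH rP xP yP rx ry.
have [<-|/eqP nrx] := eqVneq r x; first by rewrite vmax_r.
have [<-|/eqP nry] := eqVneq r y; first by rewrite vmaxC vmax_r.
have [i [iD ix]] := chain_up rP xP rx nrx.
have [j [jD jy]] := chain_up rP yP ry nry.
have iP := pos_addr rP iD; have jP := pos_addr rP jD.
have hx := ht_le ix; have hy := ht_le jy; rewrite !htE in hx hy.
have [ij|ij] := eqVneq i j.
  by apply: (IH (r + sroot i, x, y)); rewrite /m //= ?ij // !htE; lra.
have zP : pos (r + sroot i + sroot j).
  apply: pos_addr => //; apply: root_add2 => //.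
  move=> rE; have [k rk] := pos_ex rP.
  by move: rk; rewrite rE !coefE !coef_sroot; have := ler0n R (k == i); have := ler0n R (k == j); lra.
set z := r + sroot i + sroot j in zP.
have hz : ht z = ht r + 2 by rewrite /z !htE; lra.
have le_i : rle (r + sroot i) z := rle_addr _ _.
have le_j : rle (r + sroot j) z by rewrite /z addrAC; exact: rle_addr.
have aP : pos (vmax x z).
  by apply: (IH (r + sroot i, x, z)); rewrite /m //= ?hz !htE; lra.
have bP : pos (vmax y z).
  by apply: (IH (r + sroot j, y, z)); rewrite /m //= ?hz !htE; lra.
(* Taking the maximum with [z] adds at most one to each height, while the lower bound rises by two,
   counted twice in [m]. *)
have ha : ht (vmax x z) <= ht x + 1.
  rewrite -(ht_sroot j) -htD; apply/ht_le/vmax_rle; first exact: rle_addr.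
  by rewrite /z => k; have := ix k; rewrite !coefE; lra.
have hb : ht (vmax y z) <= ht y + 1.
  rewrite -(ht_sroot i) -htD; apply/ht_le/vmax_rle; first exact: rle_addr.
  by rewrite /z => k; have := jy k; rewrite !coefE; lra.
have -> : vmax x y = vmax (vmax x z) (vmax y z).
  apply: coef_inj => k; rewrite !coef_vmax.
  have zk : coef k z <= Num.max (coef k x) (coef k y).
    have := ix k; have := jy k; have := rx k; rewrite le_max /z !coefE !coef_sroot.
    have [->|_] := eqVneq k i; last by move=> _ h _; rewrite addr0 h orbT.
    by move=> _ _ h; rewrite (negPf ij) addr0 h.
  rewrite maxACA maxxx; symmetry; exact: max_l.
have h0 := ht_le (rle_vmaxr x z); have h1 := ht_le (rle_vmaxr y z).
by apply: (IH (z, vmax x z, vmax y z)); rewrite /m //= ?hz; try exact: rle_vmaxr; lra.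
Qed.

(** * Long roots *)

Definition long x := forall y, y \in Delta -> ip y y <= ip x x.

Lemma long_eq x y : x \in Delta -> y \in Delta -> long x -> long y -> ip x x = ip y y.
Proof. by move=> xD yD xL yL; apply/eqP; rewrite eq_le xL // yL. Qed.

Lemma long_ip_gt x y : x \in Delta -> y \in Delta -> long x -> x != y ->
  0 < ip y x -> 2 * ip y x = ip x x.
Proof.
move=> xD yD xL xy yx; rewrite -(cartan_ip y xD).
by rewrite cartan_eq1 ?mul1r // xL.
Qed.

Lemma long_ip_lt x y : x \in Delta -> y \in Delta -> long x -> x != - y ->
  ip y x < 0 -> 2 * ip y x = - ip x x.
Proof.
move=> xD yD xL xy yx; apply: oppr_inj; rewrite opprK -(@long_ip_gt x (- y)) //.
- by rewrite !ipE; lra.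
- by rewrite root_oppE.
- by rewrite !ipE; lra.
Qed.

Lemma long_refl a x : a \in Delta -> long x -> long (refl ip a x).
Proof. by move=> aD xL y yD; rewrite refl_ip // xL. Qed.

(** As [ip x x] is positive, a simple root in the support of [x] pairs positively with [x]; unless
    it equals [x], reflecting in it gives a lower positive root. *)
Lemma pos_ind (P : V -> Prop) :
  (forall i, P (sroot i)) ->
  (forall x i, pos x -> pos (refl ip (sroot i) x) -> 1 <= cartan ip x (sroot i) ->
     P (refl ip (sroot i) x) -> P x) ->
  forall x, pos x -> P x.
Proof.
move=> P0 PS x; elim/(@real_ind _ ht): x => x IH xP.
have [||i [_ xi]] := rle_pos_coef (x := x) (y := x).
- by move=> i; rewrite coefE pos_ge0.
- exact: ip_gt0 (pos_nz xP).
have [->//|nxi] := eqVneq x (sroot i).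
have rP := refl_sroot_pos xP nxi.
have c1 : 1 <= cartan ip x (sroot i).
  apply: int_gt0_ge1; first exact: cartan_int (sroot_root i) xP.1.
  by rewrite cartan_gt0 // ipC.
apply: (PS x i) => //; apply: IH => //.
  by apply: sumr_ge0 => k _; exact: pos_ge0.
by rewrite /refl !htE; lra.
Qed.

(* The lattice of coefficients of long roots: the image of the coroot lattice
   under the isomorphism identifying a long root with its coroot. *)
Definition longlat L x := forall i,
  coef i x * (ip (sroot i) (sroot i) / L) \is a Num.int.

(** Reflecting in [sroot i] changes the scaled coefficient by [cartan ip (sroot i) x], an integer
    because [x] is itself a root. *)
Lemma long_longlat x : pos x -> long x -> longlat (ip x x) x.
Proof.
move=> xP; have xD := xP.1; move: x xP xD; apply: pos_ind => [i _ _ j|x i xP rP c1 IH xD xL j].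
  rewrite coef_sroot; have [->|_] := eqVneq; rewrite ?mul0r ?rpred0 // mul1r.
  by rewrite divff ?rpred1 // gt_eqF // root_ip.
have := IH rP.1 (long_refl (sroot_root i) xL) j; rewrite refl_ip // => rZ.
have xE : x = refl ip (sroot i) x + cartan ip x (sroot i) *: sroot i by rewrite subrK.
rewrite {1}xE coefD mulrDl rpredD // coefZ coef_sroot.
have [->|_] := eqVneq; last by rewrite mulr0 mul0r rpred0.
rewrite mulr1 mulrA cartan_ip // ipC; exact: cartan_int.
Qed.

(** The lattice is stable under simple reflections, so the root descends inside it to a simple root;
    there the scaled coefficient [ip (sroot i) (sroot i) / L] is a positive integer, hence at least
    1. *)
Lemma longlat_long L x : 0 < L -> (forall y, y \in Delta -> ip y y <= L) ->
  pos x -> longlat L x -> ip x x = L.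
Proof.
move=> L0 Lmax; move: x; apply: pos_ind => [i iL|x i xP rP c1 IH xL].
  apply/eqP; rewrite eq_le Lmax //=; have := iL i; rewrite coef_sroot eqxx mul1r.
  by move=> /int_gt0_ge1; rewrite divr_gt0 ?root_ip // ler_pdivlMr // mul1r => ->.
rewrite -(refl_ip _ _ (sroot_root i)); apply: IH => j; rewrite /refl !coefE.
rewrite mulrBl rpredB // coef_sroot; have [->|_] := eqVneq; last by rewrite mulr0 mul0r rpred0.
rewrite mulr1 mulrA cartan_ip // ip_coef // mulr_sumr mulr_suml rpred_sum // => k _.
have -> : 2 * (coef k x * ip (sroot k) (sroot i)) / L =
   (coef k x * (ip (sroot k) (sroot k) / L)) * cartan ip (sroot i) (sroot k).
  rewrite /cartan (ipC (sroot i)); have k0 := root_ip (sroot_root k).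
  by field; rewrite !gt_eqF.
by rewrite rpredM // cartan_int.
Qed.

(** The descent of [pos_ind] preserves length and only lowers coefficients, so the simple root where
    it ends is long and in the support. *)
Lemma long_supp x : pos x -> long x -> exists i, long (sroot i) /\ 0 < coef i x.
Proof.
move: x; apply: pos_ind => [i iL|x i xP rP c1 IH xL].
  by exists i; rewrite coef_sroot eqxx.
have [j [jL xj]] := IH (long_refl (sroot_root i) xL).
exists j; split=> //; apply: lt_le_trans xj _; rewrite /refl !coefE coef_sroot.
by rewrite gerBl mulr_ge0 ?ler0n //; lra.
Qed.

(** [longlat] constrains each coefficient separately, and each coefficient of the maximum comes from
    one of two long roots of equal norm. *)
Lemma vmax_long x y : pos x -> pos y -> long x -> long y -> pos (vmax x y) ->
  long (vmax x y).
Proof.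
move=> xP yP xL yL mP; suff mE : ip (vmax x y) (vmax x y) = ip x x.
  by move=> z zD; rewrite mE xL.
apply: longlat_long => // [|i]; first exact: root_ip xP.1.
rewrite coef_vmax /Num.max; case: ifP => _; last exact: long_longlat.
by rewrite (long_eq xP.1 yP.1) //; exact: long_longlat.
Qed.

Lemma coef0_ip x i : pos x -> coef i x = 0 -> ip x (sroot i) <= 0.
Proof.
move=> xP xi; rewrite ip_coef sumr_le0 // => j _.
have [->|ji] := eqVneq j i; first by rewrite xi mul0r.
by rewrite mulr_ge0_le0 ?pos_ge0 // (sroot_ip_le0).
Qed.

Definition disj x y := forall i, 0 < coef i x -> coef i y = 0.

Lemma disj_ip x y : pos x -> pos y -> disj x y -> ip x y <= 0.
Proof.
move=> xP yP xy; rewrite ip_coef sumr_le0 // => i _.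
have := pos_ge0 i xP; rewrite le_eqVlt => /predU1P[<-|xi]; first by rewrite mul0r.
by rewrite mulr_ge0_le0 ?pos_ge0 // ipC coef0_ip // xy.
Qed.

Lemma disj_rle x y z : pos x -> disj x y -> rle x z -> rle y z -> rle (y + x) z.
Proof.
move=> xP xy xz yz i; rewrite coefD.
have := pos_ge0 i xP; rewrite le_eqVlt => /predU1P[<-|xi]; first by rewrite addr0.
by rewrite (xy i xi) add0r.
Qed.

(* [lam] is a maximal long root below [nu] (and above some long root [g2]), and
   [a_s] is a long simple root below [nu]; then [a_s] lies in the support of
   [lam].  Otherwise take a root [x] of least height with [a_s <= x <= nu], support
   disjoint from that of [lam], and [ip x lam < 0].  It is short by maximality of
   [lam], and computing [ip x x] on simple roots forces [ip x a_s > 0]; then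
   [a_s + lam + 2 (x - a_s)] has nonpositive norm. *)
Section LongSupport.
Variables (nu lam : V) (s : 'I_n).
Hypotheses (nuP : pos nu) (lamP : pos lam) (lamL : long lam) (lam_nu : rle lam nu).
Hypothesis lam_max : forall mu, pos mu -> long mu -> rle lam mu -> rle mu nu ->
  mu = lam.
Hypotheses (sL : long (sroot s)) (nus : 0 < coef s nu) (lams : coef s lam = 0).

Let L := ip lam lam.

Let L_gt0 : 0 < L. Proof. exact: root_ip lamP.1. Qed.

(** If [x] were long, its reflection in [lam] would be the long root [x + lam]; disjoint supports
    keep it below [nu], against maximality. *)
Let not_long x : pos x -> rle x nu -> disj lam x -> ip x lam < 0 -> ~ long x.
Proof.
move=> xP xnu xd xlam xL.
have c : cartan ip x lam = -1.
  have : cartan ip x lam * L = 2 * ip x lam := cartan_ip x lamP.1.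
  rewrite (@long_ip_lt lam x) ?pos_neqN //.
  by move=> h; apply: (mulIf (lt0r_neq0 L_gt0)); rewrite h mulN1r.
have xE : x + lam = refl ip lam x by rewrite /refl c scaleN1r opprK.
have xlL : long (x + lam) by rewrite xE; exact: long_refl.
have xlP : pos (x + lam).
  by apply: pos_add => //; rewrite xE; exact: refl_root.
have /eqP : x + lam = lam.
  apply: lam_max => //; last exact: disj_rle.
  by move=> i; rewrite coefD lerDr pos_ge0.
by rewrite -subr_eq0 addrK (negPf (pos_nz xP)).
Qed.

Let touching x := [/\ pos x, rle (sroot s) x, rle x nu, disj lam x & ip x lam < 0].

(** Climb from [sroot s] towards [nu]. As [lam] lies below [nu], the chain must at some point add a
    simple root from the support of [lam]; the root [x] just before that step pairs negatively with
    it, and every other term of [ip lam x] is nonpositive. *)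
Let touching_ex : exists x, touching x.
Proof.
suff H x : pos x -> rle (sroot s) x -> rle x nu -> disj lam x -> exists y, touching y.
  apply: (H (sroot s)) => //.
    move=> k; rewrite coef_sroot; have [->|_] := eqVneq; last exact: pos_ge0.
    exact: pos_coef_ge1.
  by move=> k lamk; rewrite coef_sroot; case: eqVneq lamk => // ->; rewrite lams ltxx.
elim/(@real_ind _ (fun x => ht nu - ht x)): x => x IH xP sx xnu xd.
have [j lamj] := pos_ex lamP.
have nx : x <> nu by move=> e; have := lam_nu j; rewrite -e xd // leNgt lamj.
have [i [iD inu]] := chain_up xP nuP xnu nx; have iP := pos_addr xP iD.
have := pos_ge0 i lamP; rewrite le_eqVlt => /predU1P[lami|lami].
  apply: (IH (x + sroot i)) => //.
  - by have := ht_le inu; rewrite !htE; lra.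
  - by rewrite !htE; lra.
  - by apply: rle_trans sx _; exact: rle_addr.
  move=> k lamk; rewrite coefD xd // coef_sroot; case: eqVneq lamk => [->|]; rewrite ?addr0 //.
  by rewrite -lami ltxx.
have si : (s == i) = false by apply/eqP => e; move: lami; rewrite -e lams ltxx.
have xi : ip x (sroot i) < 0.
  (* With a zero pairing, reflecting [x + sroot i] would give [x - sroot i], a root with
     coefficients of both signs. *)
  rewrite lt_neqAle coef0_ip ?xd // andbT; apply/eqP => xi0.
  have rE : refl ip (sroot i) (x + sroot i) = x - sroot i.
    have c : cartan ip (x + sroot i) (sroot i) = 2.
      by rewrite /cartan !ipE xi0 add0r mulfK // gt_eqF // root_ip.
    by rewrite /refl c scaler_nat mulr2n opprD addrA addrK.
  have rD : x - sroot i \in Delta by rewrite -rE; exact: refl_root.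
  have [_ /(_ i)] : pos (x - sroot i).
    apply: (root_pos (i := s) rD); have := sx s.
    by rewrite !coefE !coef_sroot eqxx si subr0; apply: lt_le_trans; exact: ltr01.
  by rewrite !coefE xd // coef_sroot eqxx sub0r oppr_ge0 ler10.
exists x; split=> //; rewrite ipC ip_coef (bigD1 i) //=.
apply: ltr_wnDr; last by rewrite pmulr_rlt0 // ipC.
apply: sumr_le0 => k _.
have := pos_ge0 k lamP; rewrite le_eqVlt => /predU1P[<-|lamk]; first by rewrite mul0r.
by rewrite pmulr_rle0 // ipC coef0_ip // xd.
Qed.

Lemma long_support_contra : False.
Proof.
have [x] := touching_ex; elim/(@real_ind _ ht): x => x IH [xP sx xnu xd xlam].
have lamD := lamP.1; have xD := xP.1; have x0 := root_ip xD.
have sD := sroot_root s; have sP := sroot_pos s.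
have xlamE : 2 * ip x lam = - L by apply: long_ip_lt; rewrite ?pos_neqN.
have ssL : ip (sroot s) (sroot s) = L by exact: long_eq.
have xsh : ip x x < L.
  rewrite ltNge; apply/negP => xL; apply: (not_long xP) => // y yD.
  by apply: le_trans xL; exact: lamL.
have snu : rle (sroot s) nu := rle_trans sx xnu.
have sd : disj lam (sroot s).
  by move=> k lamk; rewrite coef_sroot; case: eqVneq lamk => // ->; rewrite lams ltxx.
have slam : ip (sroot s) lam = 0.
  apply/eqP; rewrite eq_le ipC disj_ip //= leNgt ipC; apply/negP => h.
  exact: not_long h sL.
(* Here [2 * ip y lam = - L], so [L] is an integer multiple of [ip y y], by a factor larger than
   1. *)
have Lge y : y \in Delta -> ip y y < L -> ip y lam < 0 -> 2 * ip y y <= L.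
  move=> yD yL ylam; have y0 := root_ip yD.
  have ylamE : 2 * ip y lam = - L.
    apply: long_ip_lt => //; apply: contraTneq yL => e; rewrite /L e !ipE opprK; lra.
  have cZ := cartan_int yD lamD.
  have cE := cartan_ip lam yD; rewrite (ipC lam) ylamE in cE.
  have : 2 <= - cartan ip lam y by apply: int_gt1_ge2; rewrite ?rpredN //; nra.
  by nra.
have xs0 : ip x (sroot s) <= 0.
  rewrite leNgt; apply/negP => xs.
  have xsE : 2 * ip x (sroot s) = L.
    rewrite -ssL; apply: long_ip_gt => //.
    by apply: contraTneq xsh => <-; rewrite ssL ltxx.
  (* [ip v v] works out to [4 * ip x x - 2 * L], nonpositive by [Lge], whereas [coef s v] is at
     least 1. *)
  pose v := sroot s + lam + 2 *: (x - sroot s).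
  have v0 : v = 0.
    apply: (@ip_le0_eq0); rewrite /v !ipE; have := Lge x xD xsh xlam.
    rewrite (ipC lam (sroot s)) (ipC lam x) (ipC (sroot s) x) slam ssL -/L.
    by move: xlamE xsE; lra.
  have := sx s; have : coef s v = 0 by rewrite v0 coefE.
  by rewrite /v !coefE !coef_sroot1 lams; lra.
have Fle0 i : coef i x * ip (sroot i) lam <= 0.
  have := pos_ge0 i xP; rewrite le_eqVlt => /predU1P[<-|xi]; first by rewrite mul0r.
  rewrite pmulr_rle0 // ipC coef0_ip //; apply/eqP; rewrite eq_le pos_ge0 // andbT.
  by rewrite leNgt; apply/negP => /xd xi0; rewrite xi0 ltxx in xi.
have good i : 0 < coef i x * ip (sroot i) x ->
    [/\ 1 <= coef i x, 2 * ip (sroot i) lam <= - L & 2 * ip (sroot i) x = ip x x].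
  move=> h; have xi : 0 < coef i x.
    rewrite lt_neqAle pos_ge0 // andbT; apply: contraTneq h => <-.
    by rewrite mul0r ltxx.
  have ix : 0 < ip (sroot i) x by rewrite -(pmulr_rgt0 _ xi).
  have is_ : s != i by apply: contraTneq ix => <-; rewrite ipC -leNgt.
  have iD := sroot_root i.
  have xni : x != sroot i.
    apply/eqP => e; have := sx s; rewrite e !coef_sroot eqxx (negPf is_).
    by rewrite ler10.
  have yD : x - sroot i \in Delta by apply: root_sub => //; rewrite ipC.
  have inu : rle (sroot i) nu.
    apply: (@rle_trans x) => // k; rewrite coef_sroot.
    by have [->|_] := eqVneq; [exact: pos_coef_ge1|exact: pos_ge0].
  have id : disj lam (sroot i).
    move=> k lamk; rewrite coef_sroot; case: eqVneq lamk => // -> lami.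
    by move: xi; rewrite xd // ltxx.
  have yP := pos_subs xP yD.
  (* Otherwise [x - sroot i] would still pair negatively with [lam] and be a lower touching root. *)
  have lami : ip (sroot i) lam <= ip x lam.
    rewrite leNgt; apply/negP => li; apply: (IH (x - sroot i)).
    - by apply: sumr_ge0 => k _; exact: pos_ge0.
    - by rewrite !htE; lra.
    split=> //.
    - move=> k; have := sx k; rewrite !coefE !coef_sroot.
      have [->|_] := eqVneq k i; last by rewrite subr0.
      rewrite eq_sym (negPf is_) => _; have := pos_coef_ge1 xP xi.
      by rewrite subr_ge0.
    - apply: rle_trans xnu; rewrite -{2}(subrK (sroot i) x); exact: rle_addr.
    - by move=> k lamk; rewrite !coefE xd // id // subr0.
    - by rewrite !ipE; lra.
  have lami0 : ip (sroot i) lam < 0 by lra.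
  have ish : ip (sroot i) (sroot i) < L.
    rewrite ltNge; apply/negP => iL; apply: (not_long (sroot_pos i)) => // y zD.
    by apply: le_trans iL; exact: lamL.
  split; [exact: pos_coef_ge1|lra|].
  have iLE := Lge _ iD ish lami0.
  have [ixx|xii] := leP (ip (sroot i) (sroot i)) (ip x x).
    by have := cartan_ip (sroot i) xD; rewrite cartan_eq1 // mul1r.
  (* If [sroot i] is longer than [x], then [ip x x] is at most [L / 4], and [lam + 2 *: x] has
     nonpositive norm although its coefficient at [s] is nonzero. *)
  exfalso; have cE := cartan_ip (sroot i) xD.
  have ixE : 2 * ip (sroot i) x = ip (sroot i) (sroot i).
    have := cartan_ip x iD; rewrite cartan_eq1 //.
    - by rewrite mul1r ipC.
    - by rewrite eq_sym.
    - exact: ltW.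
    - by rewrite ipC.
  have : 2 <= cartan ip (sroot i) x.
    by apply: int_gt1_ge2; [exact: cartan_int|nra].
  have : 0 < ip (lam + 2 *: x) (lam + 2 *: x).
    rewrite ip_gt0 //; apply/eqP => /(congr1 (coef s)) /eqP.
    rewrite !coefE lams add0r mulf_eq0 pnatr_eq0 /= => /eqP xs; have := sx s.
    by rewrite xs coef_sroot eqxx ler10.
  by rewrite !ipE (ipC lam x) -/L; nra.
(* All terms of [2 * ip x lam = - L] are nonpositive, and one good index already accounts for [- L].
   So there is a single good index, with coefficient 1, and [ip x x] is at most half of itself. *)
have [i xi] : exists i, 0 < coef i x * ip (sroot i) x.
  exact: ip_pos_coef (root_ip xD).
have [i1 i2 i3] := good i xi.
have others j : j != i -> coef j x * ip (sroot j) x <= 0.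
  move=> ji; rewrite leNgt; apply/negP => /good[j1 j2 j3].
  move: xlamE; rewrite ip_coef (bigD1 i) //= (bigD1 j) //=.
  set r := \sum_(_ < _ | _) _; have : r <= 0 by apply: sumr_le0 => k _; exact: Fle0.
  by nra.
have ci : coef i x = 1.
  have : 2 * (coef i x * ip (sroot i) lam) >= - L.
    rewrite -xlamE (ip_coef x) (bigD1 i) //= ler_pM2l // gerDl.
    by apply: sumr_le0 => k _; exact: Fle0.
  by move: i1 i2 L_gt0; nra.
have : ip x x <= coef i x * ip (sroot i) x.
  by rewrite {1}ip_coef (bigD1 i) //= gerDl; apply: sumr_le0.
by rewrite ci; lra.
Qed.

End LongSupport.

(** Replace [g2] by a maximal long root [lam] between [g2] and [nu]. A long simple root under [g1]
    also lies under [lam], so [vmax g1 lam] is a long root; it is at most [nu], hence equal to it by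
    minimality. *)
Lemma join_long g1 g2 nu : pos g1 -> pos g2 -> long g1 -> long g2 -> pos nu ->
  rle g1 nu -> rle g2 nu ->
  (forall x, pos x -> rle g1 x -> rle g2 x -> rle nu x) -> long nu.
Proof.
move=> g1P g2P g1L g2L nuP g1n g2n nu_min.
have [lam [[lamP lamL g2lam lamn] lam_max]] : exists lam,
    [/\ pos lam, long lam, rle g2 lam & rle lam nu] /\
    forall mu, pos mu -> long mu -> rle lam mu -> rle mu nu -> mu = lam.
  suff H x : pos x -> long x -> rle g2 x -> rle x nu -> exists lam,
    [/\ pos lam, long lam, rle g2 lam & rle lam nu] /\
    forall mu, pos mu -> long mu -> rle lam mu -> rle mu nu -> mu = lam.
    exact: (H g2).
  elim/(@real_ind _ (fun x => ht nu - ht x)): x => x IH xP xL g2x xn.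
  have [[mu [muP muL xmu [mun /eqP nmu]]]|nmu] := pselect (exists mu,
     [/\ pos mu, long mu, rle x mu & rle mu nu /\ mu != x]); last first.
    exists x; split=> // mu muP muL xmu mun; apply/eqP; apply: contraT => ne.
    by exfalso; apply: nmu; exists mu.
  apply: (IH mu) => //; last exact: rle_trans g2x xmu.
    by rewrite subr_ge0 ht_le.
  have : 1 <= ht mu - ht x.
    apply: int_gt0_ge1; first by rewrite rpredB // ht_int //; exact: pos_qlat.
    by rewrite subr_gt0; apply: ht_lt => // /esym.
  by lra.
have [s [sL g1s]] := long_supp g1P g1L.
have nus : 0 < coef s nu := lt_le_trans g1s (g1n s).
have lams : 0 < coef s lam.
  rewrite lt_neqAle pos_ge0 // andbT; apply/eqP => /esym lams.
  exact: (long_support_contra nuP lamP lamL lamn lam_max sL nus lams).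
have le_s x : pos x -> 0 < coef s x -> rle (sroot s) x.
  move=> xP xs k; rewrite coef_sroot; have [->|_] := eqVneq; last exact: pos_ge0.
  exact: pos_coef_ge1.
have mP : pos (vmax g1 lam) by apply: (vmax_pos (sroot_pos s)) => //; exact: le_s.
have -> : nu = vmax g1 lam; last exact: vmax_long.
apply: rle_anti; last exact: vmax_rle.
apply: nu_min => //; first exact: rle_vmaxl.
by apply: rle_trans g2lam _; exact: rle_vmaxr.
Qed.


(** * The highest root *)

Lemma theta_dom i : 0 <= ip theta (sroot i).
Proof.
rewrite leNgt; apply/negP => ti.
have tiD : theta + sroot i \in Delta by apply: root_add => //; exact: pos_neqN.
have := theta_max (pos_addr thetaP tiD) i.
by rewrite coefD coef_sroot1; lra.
Qed.

Lemma theta_ip x : pos x -> 0 <= ip theta x.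
Proof.
move=> xP; rewrite ipC ip_coef sumr_ge0 // => i _.
by rewrite mulr_ge0 ?pos_ge0 // ipC theta_dom.
Qed.

Lemma root_le_theta x i : x \in Delta -> - coef i theta <= coef i x.
Proof.
move=> /root_posVneg[] xP; last first.
  by have := theta_max xP i; rewrite coefN; lra.
by have := pos_ge0 i xP; have := pos_ge0 i thetaP; lra.
Qed.

(** Simple reflections raise a positive root, keeping its norm, until it is dominant. For dominant
    [x], [theta - x] pairs nonnegatively with [x] and with [theta], so
    [ip x x <= ip theta x <= ip theta theta]. *)
Lemma theta_long : long theta.
Proof.
suff H x : pos x -> ip x x <= ip theta theta.
  by move=> x /root_posVneg[/H//|/H]; rewrite !ipE opprK.
elim/(@real_ind _ (fun x => ht theta - ht x)): x => x IH xP.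
have [[i xi]|dom] := pselect (exists i, ip x (sroot i) < 0).
  rewrite -(refl_ip x x (sroot_root i)).
  have c1 : 1 <= - cartan ip x (sroot i).
    apply: int_gt0_ge1; first by rewrite rpredN cartan_int.
    have := cartan_ip x (sroot_root i); have := root_ip (sroot_root i); nra.
  have rP : pos (refl ip (sroot i) x).
    by apply: refl_sroot_pos => //; apply: contraTneq xi => ->; rewrite -leNgt ip_ge0.
  apply: IH => //; first by rewrite subr_ge0; apply: ht_le; exact: theta_max.
  by rewrite /refl !htE; lra.
have xdom y : rle 0 y -> 0 <= ip y x.
  move=> y0; rewrite ip_coef sumr_ge0 // => i _; rewrite mulr_ge0 //.
    by have := y0 i; rewrite coef0.
  by rewrite ipC leNgt; apply/negP => xi; apply: dom; exists i.
have h1 : 0 <= ip (theta - x) x.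
  by apply: xdom => i; rewrite !coefE subr_ge0 theta_max.
have h2 : 0 <= ip (theta - x) theta.
  rewrite ip_coef sumr_ge0 // => i _; rewrite mulr_ge0 //.
    by rewrite !coefE subr_ge0 theta_max.
  by rewrite ipC theta_dom.
by move: h1 h2; rewrite !ipE (ipC x theta); lra.
Qed.

(** * The affine Weyl group *)

Notation A := (V * R)%type.

(** Taking the affine root itself as argument lets conjugation be stated with [areflect (w b)], as
    in [aff_refl]. *)
Definition areflect (b x : A) : A :=
  (refl ip b.1 x.1, x.2 - b.2 * cartan ip x.1 b.1).

Definition aroot (x : A) := x.1 \in Delta /\ x.2 \is a Num.int.

Definition apos (x : A) := aroot x /\ (0 < x.2 \/ x.2 = 0 /\ pos x.1).

Lemma affine_posrootE x : affine_posroot Delta Pi x <-> apos x.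
Proof.
split=> [[g [k [-> gD gk]]]|[[xD /intrP[k xk]] x0]].
  split; first by split=> //=; exact: intr_int.
  case: gk => [k1|[-> /posrootE gP]]; [left|by right] => /=.
  by rewrite ltr0z; lia.
exists x.1, k; split=> //; first by rewrite -xk -surjective_pairing.
rewrite xk ltr0z in x0; case: x0 => [|[/eqP]]; first by left; lia.
by rewrite intr_eq0 => /eqP -> xP; right; split=> //; apply/posrootE.
Qed.

Lemma apos_aroot x : apos x -> aroot x. Proof. by case. Qed.

Lemma arootN x : aroot x -> aroot (- x).
Proof. by move=> [xD xZ]; split=> /=; rewrite ?root_oppE ?rpredN. Qed.

Lemma aroot_sign x : aroot x -> apos x \/ apos (- x).
Proof.
move=> xR; have [xD xZ] := xR; have xNR := arootN xR.
have [x0|x0|x0] := ltgtP x.2 0.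
- by right; split=> //=; left; rewrite oppr_gt0.
- by left; split=> //; left.
have [xP|xP] := root_posVneg xD; [left|right]; split=> //; right; split=> //=.
by rewrite x0 oppr0.
Qed.

Lemma aposN x : apos x -> ~ apos (- x).
Proof.
move=> [_ x0] [_] /=; rewrite oppr_gt0.
case: x0 => [x0 [|[/eqP]]|[-> xP] [|[_]]]; rewrite ?ltxx //; first by lra.
  by rewrite oppr_eq0 gt_eqF.
exact: posN.
Qed.

Lemma apos_add x y : apos x -> apos y -> aroot (x + y) -> apos (x + y).
Proof.
move=> [_ x0] [_ y0] xyR; split=> //=.
case: x0 => [x0|[-> xP]]; case: y0 => [y0|[-> yP]]; rewrite ?addr0 ?add0r.
- by left; rewrite addr_gt0.
- by left.
- by left.
- by right; split=> //; apply: pos_add => //; exact: xyR.1.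
Qed.

Lemma cartan_refl a x : a \in Delta -> cartan ip (refl ip a x) a = - cartan ip x a.
Proof.
move=> aD; have a0 := root_ip aD; rewrite /refl {1}/cartan !ipE.
by rewrite /cartan; field; rewrite gt_eqF.
Qed.

Lemma areflectK b : b.1 \in Delta -> involutive (areflect b).
Proof.
move=> bD x; rewrite /areflect /= reflK // cartan_refl //.
by rewrite mulrN opprK subrK -surjective_pairing.
Qed.

Lemma areflectN b : areflect (- b) =1 areflect b.
Proof.
by move=> x; rewrite /areflect /= reflN cartanNr mulrNN.
Qed.

Lemma areflect_self b : b.1 \in Delta -> areflect b b = - b.
Proof.
move=> bD; rewrite /areflect /refl cartan_self //.
rewrite (surjective_pairing (- b)) /=; congr pair; last by lra.
by rewrite scaler_nat mulr2n opprD addrA subrr add0r.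
Qed.

Record aff (w : A -> A) : Prop := Aff {
  aff_lin : forall c x y, w (c *: x.1 + y.1, c * x.2 + y.2) =
    (c *: (w x).1 + (w y).1, c * (w x).2 + (w y).2);
  aff_ip : forall x y, ip (w x).1 (w y).1 = ip x.1 y.1;
  aff_root : forall x, aroot x -> aroot (w x);
  aff_delta : forall t, w (0, t) = (0, t) }.

Lemma areflect_aff b : aroot b -> aff (areflect b).
Proof.
move=> [bD bZ]; have b0 := root_ip bD; split=> [c x y|x y|x [xD xZ]|t].
- rewrite /areflect /= /refl; congr pair.
    rewrite [cartan ip (_ + _) _](_ : _ = c * cartan ip x.1 b.1 + cartan ip y.1 b.1).
      by rewrite scalerDl scalerBr scalerA opprD addrACA.
    by rewrite /cartan !ipE; field; rewrite gt_eqF.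
  by rewrite /cartan !ipE; field; rewrite gt_eqF.
- exact: refl_ip.
- by split; [exact: refl_root|rewrite rpredB // rpredM // cartan_int].
- by rewrite /areflect /refl /cartan /= !ipE mulr0 mul0r mulr0 scale0r !subr0.
Qed.

Lemma aff_comp w w' : aff w -> aff w' -> aff (w \o w').
Proof.
move=> [l1 i1 r1 d1] [l2 i2 r2 d2]; split=> [c x y|x y|x xR|t] /=.
- by rewrite l2 -l1.
- by rewrite i1 i2.
- exact/r1/r2.
- by rewrite d2 d1.
Qed.

Lemma aff_id : aff id.
Proof. by split. Qed.

Lemma affD w x y : aff w -> w (x + y) = w x + w y.
Proof. by move=> wA; have := aff_lin wA 1 x y; rewrite !scale1r !mul1r. Qed.

Lemma affN w x : aff w -> w (- x) = - w x.
Proof.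
move=> wA; apply: (addrI (w x)); rewrite -affD // !subrr.
exact: (aff_delta wA 0).
Qed.

Lemma affB w x y : aff w -> w (x - y) = w x - w y.
Proof. by move=> wA; rewrite affD // affN. Qed.

Lemma aff_refl w b x : aff w -> w (areflect b x) = areflect (w b) (w x).
Proof.
move=> wA; have := aff_lin wA (- cartan ip x.1 b.1) b x.
rewrite /areflect /refl /cartan !(aff_ip wA) !scaleNr !mulNr.
by rewrite ![- _ + _]addrC ![_ * b.2]mulrC ![_ * (w b).2]mulrC.
Qed.

Notation affine_weyl := (affine_weyl ip Delta).

Lemma affine_reflE b : aroot b -> exists k, affine_refl ip b.1 k = areflect b.
Proof. by move=> [bD /intrP[k bk]]; exists k; rewrite /areflect bk. Qed.

Lemma affine_weyl_comp w w' : affine_weyl w -> affine_weyl w' -> affine_weyl (w \o w').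
Proof. by move=> wW wW'; elim: wW => // b k w1 bD _; exact: affine_weyl_refl. Qed.

Lemma areflect_weyl b : aroot b -> affine_weyl (areflect b).
Proof.
move=> bR; have [k <-] := affine_reflE bR.
exact: (affine_weyl_refl k bR.1 (affine_weyl_id _ _)).
Qed.

Lemma weyl_aff w : affine_weyl w -> aff w.
Proof.
elim=> [|b k w1 bD _ w1A]; first exact: aff_id.
by apply: aff_comp => //; apply: (@areflect_aff (b, k%:~R)); split=> //=; exact: intr_int.
Qed.

Lemma weyl_inv w : affine_weyl w ->
  exists w', [/\ affine_weyl w', cancel w w' & cancel w' w].
Proof.
elim=> [|b k w1 bD _ [w1' [w1'W w1K w1'K]]]; first by exists id; split=> //; exact: affine_weyl_id.
have bR : aroot (b, k%:~R : R) by split=> //=; exact: intr_int.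
exists (w1' \o areflect (b, k%:~R)); split=> [|x|x] /=.
- by apply: affine_weyl_comp => //; exact: areflect_weyl.
- exact: etrans (congr1 w1' (areflectK bR.1 (w1 x))) (w1K x).
- by rewrite w1'K; exact: areflectK bR.1 x.
Qed.

(** * Simple affine roots, exchange, and uniqueness of Peterson's element *)

Definition asimple (a : A) := (exists i, a = (sroot i, 0)) \/ a = (- theta, 1).

Lemma theta_root : theta \in Delta. Proof. exact: pos_root. Qed.

Lemma asimple_apos a : asimple a -> apos a.
Proof.
case=> [[i ->]|->]; split=> /=; try by [right|left; exact: ltr01].
  by split=> //=; exact: rpred0.
by split=> /=; [rewrite root_oppE theta_root|exact: rpred1].
Qed.

Lemma asimple_root a : asimple a -> aroot a.
Proof. by move/asimple_apos/apos_aroot. Qed.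

Lemma cartan_theta x : x \in Delta -> x != theta -> x != - theta ->
  [\/ cartan ip x theta = 0, cartan ip x theta = 1 | cartan ip x theta = - 1].
Proof.
move=> xD x1 x2; have tD := theta_root; have t0 := root_ip tD.
have cE := cartan_ip x tD; have [h|h|h] := ltgtP (ip x theta) 0.
- apply: Or33; apply: (mulIf (lt0r_neq0 t0)); rewrite cE mulN1r.
  by apply: long_ip_lt => //; [exact: theta_long|apply: contraNneq x2 => ->; rewrite opprK].
- apply: Or32; apply: (mulIf (lt0r_neq0 t0)); rewrite cE mul1r.
  by apply: long_ip_gt => //; [exact: theta_long|rewrite eq_sym].
- by apply: Or31; apply: (mulIf (lt0r_neq0 t0)); rewrite cE h mulr0 mul0r.
Qed.

(** For a = delta - theta the level changes by the pairing with [theta], which is at most 1 in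
    absolute value away from [theta] and [- theta]. When the level falls to 0, the new finite part
    is [theta] or [theta + x.1] with [- x.1] a positive root, and is positive because [theta] is
    highest. *)
Lemma asimple_refl_apos a x : asimple a -> apos x -> x <> a -> apos (areflect a x).
Proof.
move=> aS xP xa; have [[xD xZ] x0] := xP.
split; first by apply: (aff_root (areflect_aff (asimple_root aS))); split.
case: aS xa => [[i ->]|->] xa /=.
  rewrite mul0r subr0; case: x0 => [x0|[x20 x1P]]; [by left|right; split=> //].
  apply: refl_sroot_pos => //; apply/eqP => xi; apply: xa.
  by rewrite (surjective_pairing x) xi x20.
have tD := theta_root.
rewrite mul1r cartanNr opprK reflN /refl.
have xge0 : 0 <= x.2 by case: x0 => [/ltW//|[-> _]].
have [xt|xt] := eqVneq x.1 theta.
  by left; rewrite xt cartan_self //; lra.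
have [xt'|xt'] := eqVneq x.1 (- theta).
  have c2 : cartan ip x.1 theta = - 2.
    by rewrite xt' -(cartan_self tD) /cartan !ipE mulrN mulNr.
  have x20 : 0 < x.2.
    case: x0 => // -[_]; rewrite xt' => /posN; rewrite opprK.
    by move=> /(_ thetaP).
  have x2 : 2 <= x.2.
    apply: int_gt1_ge2 => //; rewrite lt_neqAle int_gt0_ge1 // andbT.
    by apply/eqP => x21; apply: xa; rewrite (surjective_pairing x) xt' x21.
  rewrite c2; move: x2; rewrite le_eqVlt => /predU1P[<-|x2]; [right|left; lra].
  rewrite subrr xt' scaleNr opprK scaler_nat mulr2n addrA addNr add0r; split=> //.
have [->|->|cE] := cartan_theta xD xt xt'.
- by rewrite scale0r subr0 addr0.
- by left; lra.
have xneg : pos (- x.1).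
  have [xP1|//] := root_posVneg xD; have := theta_ip xP1; rewrite ipC.
  by have := cartan_ip x.1 tD; have := root_ip tD; rewrite cE; lra.
have x20 : 0 < x.2 by case: x0 => // -[_ /posN].
have := int_gt0_ge1 xZ x20; rewrite cE le_eqVlt => /predU1P[<-|x2]; last by left; lra.
right; rewrite subrr scaleN1r opprK; split=> //; split=> [|i].
  have := refl_root tD xD; rewrite /refl cE scaleN1r opprK //.
by rewrite coefD -(opprK (coef i x.1)) -coefN addrC subr_ge0 theta_max.
Qed.

Fixpoint weval (l : seq A) : A -> A :=
  if l is a :: l' then areflect a \o weval l' else id.

Definition simples (l : seq A) := forall a, a \in l -> asimple a.

Lemma simples_cons a l : simples (a :: l) <-> asimple a /\ simples l.
Proof.
split=> [h|[aS lS] b]; last by rewrite inE => /predU1P[->//|/lS].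
by split=> [|b bl]; apply: h; rewrite inE ?eqxx // bl orbT.
Qed.

Lemma simples_cat l l' : simples l -> simples l' -> simples (l ++ l').
Proof. by move=> lS lS' a; rewrite mem_cat => /orP[/lS|/lS']. Qed.

Lemma weval_cat l l' x : weval (l ++ l') x = weval l (weval l' x).
Proof. by elim: l => //= a l ->. Qed.

Lemma weval_aff l : simples l -> aff (weval l).
Proof.
elim: l => [_|a l IH /simples_cons[aS lS]]; first exact: aff_id.
by apply: aff_comp (IH lS); exact/areflect_aff/asimple_root.
Qed.

(** Otherwise [b.1] pairs nonpositively with every simple root and nonnegatively with [theta]. But
    [ip b.1 b.1 > 0] yields a simple root pairing negatively with [b.1], and it lies in the support
    of [theta]. *)
Lemma asimple_ip_gt0 b : apos b -> exists2 a, asimple a & 0 < ip b.1 a.1.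
Proof.
move=> [[bD bZ] b0]; apply: contrapT => nb.
have b_le i : ip (sroot i) b.1 <= 0.
  rewrite ipC leNgt; apply/negP => h; apply: nb; exists (sroot i, 0) => //; left.
  by exists i.
have bt : 0 <= ip theta b.1.
  rewrite leNgt; apply/negP => h; apply: nb; exists (- theta, 1); first by right.
  by rewrite /= ipNr oppr_gt0 ipC.
have [i bi] := ip_pos_coef (root_ip bD).
have := b_le i; rewrite le_eqVlt => /predU1P[ib|ib]; first by rewrite ib mulr0 ltxx in bi.
have bi0 : coef i b.1 < 0 by rewrite -(nmulr_lgt0 _ ib).
have ti : 0 < coef i theta by have := root_le_theta i bD; lra.
suff : ip theta b.1 < 0 by rewrite ltNge bt.
rewrite ip_coef (bigD1 i) //=; apply: ltr_wnDr; last by rewrite pmulr_rlt0.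
by apply: sumr_le0 => k _; rewrite mulr_ge0_le0 ?pos_ge0.
Qed.

Lemma areflect_gen b : apos b -> exists2 l, simples l & areflect b =1 weval l.
Proof.
(* The affine height: delta counts for [ht theta + 1], so that every simple affine root has height
   1. *)
pose m (b : A) := ht b.1 + b.2 * (ht theta + 1).
have m_ge0 x : apos x -> 0 <= m x.
  move=> [[xD xZ] [x0|[x0 xP]]]; rewrite /m.
    have x1 := int_gt0_ge1 xZ x0.
    have : - ht theta <= ht x.1.
      by rewrite -htN; apply: ht_le => i; rewrite coefN; exact: root_le_theta.
    have : 0 <= ht theta by apply: sumr_ge0 => i _; exact: pos_ge0.
    by nra.
  by rewrite x0 mul0r addr0; apply: sumr_ge0 => i _; exact: pos_ge0.
elim/(@real_ind _ m): b => b IH bP; have bR := apos_aroot bP.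
have [aS|nbS] := pselect (asimple b).
  by exists [:: b] => // a; rewrite inE => /eqP ->.
have [a aS ab] := asimple_ip_gt0 bP; have aR := asimple_root aS.
have m_a : m a = 1.
  case: (aS) => [[i ->]|->]; rewrite /m /= ?htE; lra.
have ba : b <> a by move=> e; apply: nbS; rewrite e.
have b'P := asimple_refl_apos aS bP ba.
have c1 : 1 <= cartan ip b.1 a.1.
  by apply: int_gt0_ge1; [exact: cartan_int aR.1 bR.1|rewrite cartan_gt0 // aR.1].
have [l lS lE] : exists2 l, simples l & areflect (areflect a b) =1 weval l.
  apply: IH => //; first exact: m_ge0.
  by move: m_a; rewrite /m /areflect /refl /= !htE; nra.
exists (a :: l ++ [:: a]).
  apply/simples_cons; split=> //; apply: simples_cat => // c.
  by rewrite inE => /eqP ->.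
move=> x /=; rewrite weval_cat /= -lE.
rewrite -(aff_refl b x (areflect_aff aR)) areflectK //; exact: aR.1.
Qed.

Lemma weyl_gen w : affine_weyl w -> exists2 l, simples l & w =1 weval l.
Proof.
elim=> [|b k w1 bD _ [l lS lE]]; first by exists [::].
have bR : aroot (b, k%:~R : R) by split=> //=; exact: intr_int.
have [l' lS' lE'] : exists2 l, simples l & areflect (b, k%:~R) =1 weval l.
  have [/areflect_gen//|/areflect_gen[l' lS' lE']] := aroot_sign bR.
  by exists l' => // x; rewrite -lE' areflectN.
exists (l' ++ l); first exact: simples_cat.
by move=> x; rewrite weval_cat /= -lE -lE'.
Qed.

(* If [weval l a] is negative, some suffix [l'] of [l] satisfies
   [weval l' a = b] for the letter [b] preceding it, and that letter cancels
   against [a]. *)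
Lemma exchange l a : simples l -> asimple a -> apos (- weval l a) ->
  exists2 l', simples l' /\ (size l').+1 = size l &
    forall x, weval l (areflect a x) = weval l' x.
Proof.
move=> lS aS; elim: l lS => [_|b l IH /simples_cons[bS lS]] /=.
  by move=> /aposN; rewrite opprK => /(_ (asimple_apos aS)).
have lA := weval_aff lS; have laR := aff_root lA (asimple_root aS).
have bR := asimple_root bS.
have [laP|laN] := aroot_sign laR; last first.
  have [l' [lS' ls] lE] := IH lS laN; exists (b :: l').
    by split; [apply/simples_cons|rewrite /= ls].
  by move=> x /=; rewrite lE.
move=> nP; have [lab|/eqP lab] := eqVneq (weval l a) b; last first.
  by have := asimple_refl_apos bS laP lab => /aposN.
exists l => // x; rewrite aff_refl // lab areflectK //; exact: bR.1.
Qed.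

(** The last letter stays positive under the word, so the word without it sends that letter to a
    negative root; [exchange] then gives an equivalent word shorter by two. *)
Lemma weval_pos_id l : simples l -> (forall x, apos x -> apos (weval l x)) ->
  weval l =1 id.
Proof.
have [k] := ubnP (size l); elim: k l => // k IH l; case/lastP: l => [//|l a].
rewrite size_rcons ltnS => lk laS lP.
have /simples_cons[aS lS] : simples (a :: l).
  by move=> b; rewrite -mem_rcons => /laS.
have lE x : weval (rcons l a) x = weval l (areflect a x) by rewrite -cats1 weval_cat.
have la : apos (- weval l a).
  have := lP a (asimple_apos aS); rewrite lE areflect_self; last exact: (asimple_root aS).1.
  by rewrite affN //; exact: weval_aff.
have [l' [lS' ls] lE'] := exchange lS aS la.
move=> x; rewrite lE lE'; apply: IH => //; first by rewrite -ls in lk; exact: ltnW.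
by move=> y /lP; rewrite lE lE'.
Qed.

Lemma weyl_pos_id u : affine_weyl u -> (forall x, apos x -> apos (u x)) -> u =1 id.
Proof.
move=> /weyl_gen[l lS lE] uP x; rewrite lE; apply: weval_pos_id => // y /uP.
by rewrite lE.
Qed.

(* [elt I w] says that [w] is the element [w_I] of Peterson. *)
Definition elt (I : set V) w := affine_weyl w /\
  forall x, apos x /\ apos (- w x) <-> exists2 g, I g & x = (- g, 1).

(** As [w] and [w'] invert the same roots, [w' \o w^-1] keeps positive roots positive. This allows
    the description [ideal_elt] to be evaluated at any element obtained by construction. *)
Lemma elt_uniq I w w' : elt I w -> elt I w' -> w = w'.
Proof.
move=> [wW wI] [wW' wI']; have wA := weyl_aff wW; have wA' := weyl_aff wW'.
have [v [vW wK vK]] := weyl_inv wW; have vA := weyl_aff vW.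
have uE : w' \o v =1 id.
  apply: weyl_pos_id; first exact: affine_weyl_comp.
  move=> x xP /=; have vxR := aff_root vA (apos_aroot xP).
  have [vxP|vxN] := aroot_sign vxR.
    have [//|n] := aroot_sign (aff_root wA' vxR).
    have /wI[_] := (wI' (v x)).1 (conj vxP n).
    by rewrite vK => /(aposN xP).
  have : apos (- v x) /\ apos (- w (- v x)) by rewrite affN // vK opprK.
  by move=> /wI/wI'[_]; rewrite affN // opprK.
by apply/funext => x; rewrite -[in RHS](wK x); exact/esym/uE.
Qed.

Lemma theE (T : choiceType) (x0 x : T) (P : set T) : P = [set x] -> the x0 P = x.
Proof.
move=> Px; apply: xget_unique => // y /= Py.
by have : [set x] x by []; rewrite -Px Py => ->.
Qed.

Lemma theP (T : choiceType) (x0 : T) (P : set T) :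
  the x0 P <> x0 -> P = [set the x0 P].
Proof. by rewrite /the; case: xgetP. Qed.

Lemma eltE I w : elt I w <-> affine_weyl w /\
  inversions Delta Pi w = [set (- g, 1) | g in I].
Proof.
split=> -[wW wI]; split=> //.
  apply/seteqP; split=> x /=.
    by move=> [/affine_posrootE xP /affine_posrootE nP]; have [g Ig ->] := (wI x).1 (conj xP nP); exists g.
  by move=> [g Ig <-]; have [] := (wI (- g, 1)).2 (ex_intro2 _ _ g Ig erefl); split; apply/affine_posrootE.
move=> x; have : inversions Delta Pi w x = [set (- g, 1) | g in I] x by rewrite wI.
rewrite /inversions /= => e; split=> [[xP nP]|[g Ig xE]].
  have : affine_posroot Delta Pi x /\ affine_posroot Delta Pi (- w x).
    by split; apply/affine_posrootE.
  by rewrite e => -[g Ig <-]; exists g.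
have : exists2 x0 : V, I x0 & (- x0, 1) = x by exists g.
by rewrite -e => -[]; split; apply/affine_posrootE.
Qed.

Lemma ideal_elt_eq I w : elt I w -> ideal_elt ip Delta Pi I = w.
Proof.
move=> wE; apply: theE; apply/seteqP; split=> [w' /eltE|w' ->]; last exact/eltE.
by move=> w'E; exact: (elt_uniq w'E wE).
Qed.

(** * Abelian ideals from inversion sets *)

Definition allpos (J : set V) := forall g, J g -> pos g.

Lemma elt_apos J w x : elt J w -> apos x -> (forall g, J g -> x <> (- g, 1)) ->
  apos (w x).
Proof.
move=> [wW wJ] xP xJ; have [//|n] := aroot_sign (aff_root (weyl_aff wW) (apos_aroot xP)).
by have [g Jg /xJ[]] := (wJ x).1 (conj xP n).
Qed.

Lemma elt_in J w g : elt J w -> J g -> apos (- w (- g, 1)).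
Proof. by move=> [_ wJ] Jg; have [] := (wJ (- g, 1)).2 (ex_intro2 _ _ g Jg erefl). Qed.

Lemma fin_apos g : pos g -> apos (g, 0).
Proof. by move=> gP; split; [split=> //=; exact: rpred0|right]. Qed.

Lemma delta_apos g : g \in Delta -> apos (g, 1).
Proof. by move=> gD; split; [split=> //=; exact: rpred1|left; exact: ltr01]. Qed.

Lemma elt_fin J w g : elt J w -> pos g -> apos (w (g, 0)).
Proof.
move=> wE gP; apply: (elt_apos wE); first exact: fin_apos.
by move=> h _ [_ /esym/eqP]; rewrite oner_eq0.
Qed.

Definition abelian (J : set V) := [/\ allpos J,
  forall g h, J g -> pos h -> rle g h -> J h &
  forall g h, J g -> J h -> g + h \notin Delta].

(** If w makes delta - g negative, it does the same to delta - g - a_i, because finite positive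
    roots stay positive; this gives upward closure. If g + h were a root, 2 delta - g - h would be
    inverted at level 2, where no inversion lies. *)
Lemma elt_abelian J w : elt J w -> allpos J -> abelian J.
Proof.
move=> wE JP; have wA := weyl_aff wE.1; split=> // [g h|g h].
  elim/(@real_ind _ (fun g => ht h - ht g)): g => g IH Jg hP gh.
  have [<-//|/eqP ngh] := eqVneq g h.
  have gP := JP g Jg; have [i [iD ih]] := chain_up gP hP gh ngh.
  apply: (IH (g + sroot i)) => //.
  - by rewrite subr_ge0 ht_le.
  - by rewrite !htE; lra.
  have xP : apos (- (g + sroot i), 1) by apply: delta_apos; rewrite root_oppE.
  have xE : (- (g + sroot i), 1) = (- g, 1) - (sroot i, 0) :> V * R.
    by congr pair => /=; rewrite ?opprD ?subr0.
  have nP : apos (- w (- (g + sroot i), 1)).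
    rewrite xE affB // opprB addrC; apply: apos_add; first exact: (elt_in wE).
      by apply: (elt_fin wE).
    rewrite addrC -opprB -affB // -xE; apply: arootN; apply: (aff_root wA).
    exact: apos_aroot.
  by have [k Jk [/oppr_inj ->]] := (wE.2 _).1 (conj xP nP).
move=> Jg Jh; apply/negP => ghD.
have xE : (- (g + h), 2) = (- g, 1) + (- h, 1) :> V * R.
  by congr pair => /=; rewrite ?opprD.
have xR : aroot (- (g + h), 2 : R) by split; rewrite /= ?root_oppE // (natr_int R 2).
have xP : apos (- (g + h), 2 : R) by split=> //; left; rewrite /= ltr0n.
have nP : apos (- w (- (g + h), 2)).
  rewrite xE affD // opprD; apply: apos_add; try exact: (elt_in wE).
  by rewrite -opprD -affD // -xE; apply: arootN; exact: (aff_root wA).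
have [k _ [_ /eqP]] := (wE.2 _).1 (conj xP nP).
by rewrite -subr_eq0 (_ : 2 - 1 = 1 :> R) ?oner_eq0 //; lra.
Qed.

(** The reflection in [b] changes the sign of no affine root except [b] and [- b], so the only new
    inversion is the preimage of [b]. *)
Lemma elt_add J w nu b : elt J w -> pos nu -> ~ J nu -> w (- nu, 1) = b ->
  asimple b -> elt (J `|` [set nu]) (areflect b \o w).
Proof.
move=> [wW wJ] nuP nJ wb bS; have wA := weyl_aff wW; have bR := asimple_root bS.
have rA := areflect_aff bR; have [v [_ wK _]] := weyl_inv wW.
split; first exact: affine_weyl_comp (areflect_weyl bR) wW.
have nuA : apos (- nu, 1) by apply: delta_apos; rewrite root_oppE.
have wnu : areflect b (w (- nu, 1)) = - b by rewrite wb areflect_self // bR.1.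
have other x : apos x -> x <> (- nu, 1) -> apos (w x) <-> apos (areflect b (w x)).
  move=> xP xnu; have wxR := aff_root wA (apos_aroot xP).
  have wxb : w x <> b by move=> e; apply: xnu; apply: (can_inj wK); rewrite e.
  have wxNb : - w x <> b.
    rewrite -affN // => e; have xE : - x = (- nu, 1) by apply: (can_inj wK); rewrite e.
    by apply: (aposN xP); rewrite xE.
  split; first by move=> wxP; exact: asimple_refl_apos.
  move=> rP; have [//|n] := aroot_sign wxR; have := asimple_refl_apos bS n wxNb.
  by rewrite affN // => /(aposN rP).
move=> x; split=> [[xP /= nP]|].
  have [->|/eqP xnu] := eqVneq x (- nu, 1); first by exists nu => //; right.
  have [wxP|wxN] := aroot_sign (aff_root wA (apos_aroot xP)).
    by move/(other x xP xnu)/aposN: wxP.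
  by have [g Jg ->] := (wJ x).1 (conj xP wxN); exists g => //; left.
move=> [g [Jg|/= ->] ->]; last by split=> //=; rewrite wnu opprK; exact: asimple_apos.
have [xP nP] := (wJ (- g, 1)).2 (ex_intro2 _ _ g Jg erefl); split=> //=.
have gnu : (- g, 1 : R) <> (- nu, 1) by move=> [/oppr_inj e]; apply: nJ; rewrite -e.
have [rP|//] := aroot_sign (aff_root rA (aff_root wA (apos_aroot xP))).
by move/(other _ xP gnu)/aposN: rP.
Qed.

(** Since delta is not a real root, splitting it off is a separate hypothesis. It handles levels
    above 1 and positive finite parts at level 1; in the remaining nonsimple cases a simple root can
    be split off, at level 1 because [- b.1] can be raised towards [theta]. *)
Lemma affine_indec b : apos b ->
  (forall b1 b2, apos b1 -> apos b2 -> b <> b1 + b2) ->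
  (forall b1, apos b1 -> b <> b1 + (0, 1)) -> asimple b.
Proof.
move=> [[bD bZ] b0] nb nbd; apply: contrapT => bS.
have decE i k : (b.1, k) = (b.1 - sroot i, k) + (sroot i, 0) :> A.
  by congr pair => /=; rewrite ?subrK ?addr0.
case: b0 => [b0|[b20 bP]]; last first.
  have [||i [_ bi]] := @rle_pos_coef b.1 b.1.
  - by move=> i; rewrite coef0 pos_ge0.
  - exact: root_ip.
  have bni : b.1 != sroot i.
    by apply/eqP => e; apply: bS; left; exists i; rewrite -e -b20 -surjective_pairing.
  have rP : pos (b.1 - sroot i).
    by apply: pos_subs => //; apply: root_sub => //; rewrite ipC.
  apply: (nb _ _ (fin_apos rP) (fin_apos (sroot_pos i))).
  by rewrite -decE -b20 -surjective_pairing.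
have b1 := int_gt0_ge1 bZ b0.
have bE : b = (b.1, b.2 - 1) + (0, 1).
  by rewrite [LHS]surjective_pairing; congr pair => /=; rewrite ?addr0 ?subrK.
move: (b1); rewrite le_eqVlt => /predU1P[b1E|b1']; last first.
  apply: nbd bE; split; first by split=> //=; rewrite rpredB ?rpred1.
  by left; rewrite /= subr_gt0.
have [bP|bP] := root_posVneg bD.
  by apply: nbd bE; rewrite -b1E subrr; exact: fin_apos.
have nt : - b.1 <> theta.
  move=> e; apply: bS; right; rewrite [LHS]surjective_pairing -b1E -e opprK //.
have [i [iD _]] := chain_up bP thetaP (theta_max bP) nt.
have rD : b.1 - sroot i \in Delta by rewrite -root_oppE opprB addrC.
apply: (nb _ _ (delta_apos rD) (fin_apos (sroot_pos i))).
by rewrite -decE b1E -surjective_pairing.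
Qed.

(** * Rootlets *)

(** Let x be the preimage of a_i. Invariance of the form gives [ip x.1 theta < 0], so [x.1] is a
    negative root, and x is positive since [- x] cannot be an inversion. At level 2 or more, x - (2
    delta - theta), the preimage of a_i - g, would be an inversion with positive finite part. So x
    is delta - nu with nu positive. *)
Lemma rootlet_step J w g i : elt J w -> allpos J -> w (- theta, 2) = (g, 0) ->
  pos g -> long g -> 0 < ip g (sroot i) -> g <> sroot i ->
  exists nu w', [/\ pos nu, elt (J `|` [set nu]) w' &
    w' (- theta, 2) = (refl ip (sroot i) g, 0)].
Proof.
move=> wE JP wg gP gL gi ngi; have wA := weyl_aff wE.1.
have [v [vW wK vK]] := weyl_inv wE.1; have vA := weyl_aff vW.
have iA := fin_apos (sroot_pos i).
have inJ y : apos y -> apos (- w y) -> exists2 h, J h & y = (- h, 1).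
  by move=> yP ny; exact: (wE.2 y).1 (conj yP ny).
pose x := v (sroot i, 0); have wx : w x = (sroot i, 0) by rewrite /x vK.
have xR : aroot x := aff_root vA (apos_aroot iA).
have xt : ip x.1 theta < 0.
  have := aff_ip wA x (- theta, 2); rewrite wx wg /= ipNr ipC; lra.
have xneg : pos (- x.1).
  have [xP|//] := root_posVneg xR.1; have := theta_ip xP; rewrite ipC; lra.
have xA : apos x.
  have [//|xN] := aroot_sign xR.
  have [|h Jh /(congr1 fst) /= e] := inJ (- x) xN; first by rewrite (affN _ wA) opprK wx.
  by case: (posN xneg); rewrite e opprK; exact: JP.
have x20 : 0 < x.2 by case: xA => _ [//|[_ /posN]].
have gE : (g - sroot i, 0) = (g, 0) - (sroot i, 0) :> A.
  by congr pair; rewrite /= subr0.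
have rP : pos (g - sroot i).
  by apply: pos_subs => //; apply: root_sub => //; apply/eqP.
have ry : w ((- theta, 2) - x) = (g - sroot i, 0) by rewrite affB // wg wx gE.
have yR : aroot ((- theta, 2) - x).
  have := aff_root vA (apos_aroot (fin_apos rP)); rewrite -ry wK //.
have x21 : x.2 = 1.
  apply/eqP; rewrite eq_le int_gt0_ge1 ?andbT //; last exact: xR.2.
  rewrite leNgt; apply/negP => /(int_gt1_ge2 xR.2) x2.
  have yD : theta + x.1 \in Delta by move: yR.1; rewrite /= -opprD root_oppE.
  have yP : pos (theta + x.1).
    by split=> // k; have := root_le_theta k xR.1; rewrite coefD; lra.
  have yN : apos (- ((- theta, 2) - x)).
    split; first exact: arootN.
    have -> : (- ((- theta, 2) - x)).1 = theta + x.1 by rewrite /= opprB opprK addrC.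
    have -> : (- ((- theta, 2) - x)).2 = x.2 - 2 by rewrite /= opprB.
    move: x2; rewrite le_eqVlt => /predU1P[<-|x2].
      by right; rewrite subrr.
    by left; rewrite subr_gt0.
  have [|h Jh /(congr1 fst) /= e] := inJ _ yN.
    by rewrite (affN _ wA) ry opprK; exact: fin_apos.
  have yE : theta + x.1 = - h by rewrite -e opprB opprK addrC.
  by case: (posN yP); rewrite yE opprK; exact: JP.
exists (- x.1), (areflect (sroot i, 0) \o w); split=> //.
  have xE : (- - x.1, 1) = x by rewrite opprK -x21 -surjective_pairing.
  apply: elt_add => //; rewrite ?xE //; last by left; exists i.
  by move=> Jx; have := elt_in wE Jx; rewrite xE wx => /(aposN iA).
by rewrite /= wg /areflect /= mul0r subr0.
Qed.

(** The coefficients of [g] and [g'] at [i] differ by a multiple of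
    [ip g g / ip (sroot i) (sroot i)], by [longlat]. Reflecting a long root in [sroot i] changes its
    coefficient by exactly that unit, so a step from one towards the other does not overshoot. *)
Lemma rootlet_down g g' J w : pos g -> long g -> pos g' -> long g' -> rle g' g ->
  elt J w -> allpos J -> w (- theta, 2) = (g, 0) ->
  exists J' w', [/\ J `<=` J', elt J' w', allpos J' & w' (- theta, 2) = (g', 0)].
Proof.
pose m (t : V * V) := ht t.1 - ht t.2; move: g g' J w.
suff H (t : V * V) J w : pos t.1 -> long t.1 -> pos t.2 -> long t.2 -> rle t.2 t.1 ->
    elt J w -> allpos J -> w (- theta, 2) = (t.1, 0) ->
  exists J' w', [/\ J `<=` J', elt J' w', allpos J' & w' (- theta, 2) = (t.2, 0)].
  by move=> g g' J w; exact: (H (g, g')).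
elim/(@real_ind _ m): t J w => -[g g'] IH J w /=.
move=> gP gL g'P g'L g'g wE JP wg.
have [->|/eqP ng] := eqVneq g' g; first by exists J, w; split.
have [i [igg ip_i]] := rle_pos_neq g'g ng.
have i0 := root_ip (sroot_root i); have g0 := root_ip (pos_root gP).
have step : ip g g <= (coef i g - coef i g') * ip (sroot i) (sroot i).
  have : 1 <= coef i g * (ip (sroot i) (sroot i) / ip g g) -
       coef i g' * (ip (sroot i) (sroot i) / ip g g).
    apply: int_gt0_ge1.
      rewrite rpredB ?(long_longlat gP) //.
      by rewrite (@long_eq g g') //; exact: long_longlat.
    by rewrite -mulrBl mulr_gt0 ?subr_gt0 // divr_gt0.
  by rewrite -mulrBl mulrA ler_pdivlMr // mul1r.
have addP J1 nu : allpos J1 -> pos nu -> allpos (J1 `|` [set nu]).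
  by move=> J1P nuP h [/J1P//|->].
have [gi|gi] := ltP 0 (ip g (sroot i)).
  have ngi : g <> sroot i by move=> e; apply: ng; rewrite e; apply: rle_sroot_eq; rewrite -?e.
  have [nu [w1 [nuP w1E w1g]]] := rootlet_step wE JP wg gP gL gi ngi.
  have cE : cartan ip g (sroot i) * ip (sroot i) (sroot i) = ip g g.
    by rewrite cartan_ip // ipC; apply: long_ip_gt => //; [apply/eqP|rewrite ipC].
  have rg : rle g' (refl ip (sroot i) g).
    move=> k; rewrite /refl !coefE coef_sroot; have [->|_] := eqVneq k i.
      by rewrite mulr1; nra.
    by rewrite mulr0 subr0 g'g.
  have rP : pos (refl ip (sroot i) g) by apply: refl_sroot_pos => //; apply/eqP.
  have m0 : 0 <= m (refl ip (sroot i) g, g') by rewrite /m subr_ge0 ht_le.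
  have m1 : m (refl ip (sroot i) g, g') + 1 <= m (g, g').
    have : 1 <= cartan ip g (sroot i) by apply: int_gt0_ge1; rewrite ?cartan_int ?cartan_gt0.
    by rewrite /m /refl /= !htE; lra.
  have [J' [w' [JJ' w'E J'P w'g]]] := IH _ m0 m1 _ _ rP (long_refl (sroot_root i) gL)
    g'P g'L rg w1E (addP _ _ JP nuP) w1g.
  by exists J', w'; split=> // h Jh; apply: JJ'; left.
(* When [g] cannot be lowered along [sroot i], [g'] can be raised: the reflected root is reached
   first, and one last step leads down to [g']. *)
have g'i : ip g' (sroot i) < 0.
  by move: ip_i; rewrite ipDr ipNr !(ipC (sroot i)); lra.
have ng'i : g' != sroot i by apply: contraTneq g'i => ->; rewrite -leNgt ltW.
have rP := refl_sroot_pos g'P ng'i.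
have rL : long (refl ip (sroot i) g') := long_refl (sroot_root i) g'L.
have cE : cartan ip g' (sroot i) * ip (sroot i) (sroot i) = - ip g g.
  rewrite cartan_ip // ipC (@long_eq g g') //; apply: long_ip_lt => //.
    exact: pos_neqN.
  by rewrite ipC.
have rg : rle (refl ip (sroot i) g') g.
  move=> k; rewrite /refl !coefE coef_sroot; have [->|_] := eqVneq k i.
    by rewrite mulr1; nra.
  by rewrite mulr0 subr0 g'g.
have m0 : 0 <= m (g, refl ip (sroot i) g') by rewrite /m subr_ge0 ht_le.
have m1 : m (g, refl ip (sroot i) g') + 1 <= m (g, g').
  have : 1 <= - cartan ip g' (sroot i).
    by apply: int_gt0_ge1; [rewrite rpredN cartan_int|nra].
  by rewrite /m /refl /= !htE; lra.
have [J1 [w1 [JJ1 w1E J1P w1g]]] := IH _ m0 m1 _ _ gP gL rP rL rg wE JP wg.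
have ri : 0 < ip (refl ip (sroot i) g') (sroot i).
  by rewrite /refl !ipE cartan_ip //; lra.
have nri : refl ip (sroot i) g' <> sroot i.
  move=> e; have : pos (refl ip (sroot i) (sroot i)) by rewrite -{2}e reflK.
  rewrite /refl cartan_self // scaler_nat mulr2n opprD addrA subrr add0r.
  exact: posN.
have [nu [w2 [nuP w2E w2g]]] := rootlet_step w1E J1P w1g rP rL ri nri.
exists (J1 `|` [set nu]), w2; split=> //; last by rewrite w2g reflK.
- by move=> h /JJ1; left.
- exact: addP.
Qed.

(* A maximal [nu] in [K] but not in [J] makes [w (delta - nu)] indecomposable,
   hence affine simple. *)
Lemma ideal_add J K w g : abelian K -> J `<=` K -> J <> K -> elt J w ->
  w (- theta, 2) = (g, 0) -> pos g ->
  exists nu w' g', [/\ K nu, ~ J nu, elt (J `|` [set nu]) w',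
    w' (- theta, 2) = (g', 0) & pos g' /\ rle g' g].
Proof.
move=> [KP Kup Kab] JK nJK wE wg gP; have wA := weyl_aff wE.1.
have [v [vW wK vK]] := weyl_inv wE.1; have vA := weyl_aff vW.
have [nu [Knu nJ nu_max]] : exists nu, [/\ K nu, ~ J nu &
    forall h, K h -> ~ J h -> rle nu h -> h = nu].
  have [h [Kh nJh]] : exists h, K h /\ ~ J h.
    apply: contrapT => nh; apply: nJK; apply/seteqP; split=> // h Kh.
    by apply: contrapT => nJh; apply: nh; exists h.
  elim/(@real_ind _ (fun h => ht theta - ht h)): h Kh nJh => h IH Kh nJh.
  have [[k [Kk nJk hk /eqP nkh]]|nk] := pselect (exists k, [/\ K k, ~ J k, rle h k & k != h]).
    apply: (IH k) => //; first by rewrite subr_ge0 ht_le //; apply/theta_max/KP.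
    have : 1 <= ht k - ht h.
      apply: int_gt0_ge1; first by rewrite rpredB // ht_int //; apply/pos_qlat/KP.
      by rewrite subr_gt0; apply: ht_lt => // /esym.
    by lra.
  exists h; split=> // k Kk nJk hk; apply/eqP; apply: contraT => nkh.
  by exfalso; apply: nk; exists k.
have nuP := KP nu Knu; have nuA : apos (- nu, 1) by apply: delta_apos; rewrite root_oppE.
have bP : apos (w (- nu, 1)).
  by apply: (elt_apos wE) => // h Jh [/oppr_inj e]; apply: nJ; rewrite e.
have bS : asimple (w (- nu, 1)).
  apply: affine_indec => // [b1 b2 b1P b2P bE|b1 b1P bE].
    have x12 : v b1 + v b2 = (- nu, 1) by rewrite -affD // -bE wK.
    (* A negative [v c1] would be the opposite of delta - h with [h] in [J], making [nu + h] a root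
       although [K] is abelian. *)
    have vpos c1 c2 : apos c1 -> apos c2 -> v c1 + v c2 = (- nu, 1) -> apos (v c1).
      move=> c1P c2P cE; have c1R := aff_root vA (apos_aroot c1P).
      have [//|c1N] := aroot_sign c1R.
      have [|h Jh hE] := (wE.2 (- v c1)).1; first by rewrite affN // vK opprK.
      have := (aff_root vA (apos_aroot c2P)).1.
      have -> : v c2 = (- nu, 1) - v c1 by rewrite -cE addrC addKr.
      by rewrite hE /= -opprD root_oppE (negPf (Kab _ _ Knu (JK h Jh))).
    (* A summand at level 0 is a positive root p, and the other is delta - (nu + p). Maximality of
       [nu] puts nu + p in [J], yet [w] sends that summand to the positive root [c1]. *)
    have vzero c1 c2 : apos c1 -> apos c2 -> v c1 + v c2 = (- nu, 1) ->
        (v c2).2 = 0 -> False.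
      move=> c1P c2P cE c20; have [c2R c2'] := vpos _ _ c2P c1P (etrans (addrC _ _) cE).
      have pP : pos (v c2).1 by case: c2' => [|[]//]; rewrite c20 ltxx.
      have c1E : v c1 = (- (nu + (v c2).1), 1).
        have -> : v c1 = (- nu, 1) - v c2 by rewrite -cE addrK.
        by congr pair; rewrite /= ?opprD // c20 subr0.
      have sD : nu + (v c2).1 \in Delta.
        by have := (aff_root vA (apos_aroot c1P)).1; rewrite c1E /= root_oppE.
      have sP : pos (nu + (v c2).1) := pos_add nuP pP sD.
      have le_s : rle nu (nu + (v c2).1) by move=> k; rewrite coefD lerDl pos_ge0.
      have Ks := Kup _ _ Knu sP le_s.
      have nJs : ~ J (nu + (v c2).1).
        by move=> Js; have := elt_in wE Js; rewrite -c1E vK => /(aposN c1P).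
      have /eqP := nu_max _ Ks nJs le_s.
      by rewrite -subr_eq0 addrC addKr (negPf (pos_nz pP)).
    have [[_ z1] p1] := vpos _ _ b1P b2P x12.
    have x21 : v b2 + v b1 = (- nu, 1) by rewrite addrC.
    have [[_ z2] p2] := vpos _ _ b2P b1P x21.
    have s12 : (v b1).2 + (v b2).2 = 1 := congr1 snd x12.
    case: p1 => [/(int_gt0_ge1 z1) p1|[p1 _]]; last exact: (vzero _ _ b2P b1P x21).
    case: p2 => [/(int_gt0_ge1 z2) p2|[p2 _]]; last exact: (vzero _ _ b1P b2P x12).
    by move: s12; lra.
  have nuE : (- nu, 1) = (- nu, 0) + (0, 1) :> A by congr pair; rewrite /= ?addr0 ?add0r.
  move: bE; rewrite nuE affD // (aff_delta wA) => /addIr b1E.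
  have : (- nu, 0) = - (nu, 0) :> A by congr pair; rewrite /= oppr0.
  by move=> e; move: b1P; rewrite -b1E e affN // => /(aposN (elt_fin wE nuP)).
(* The pairing equals [ip nu theta]. Hence reflecting in a finite simple root can only lower [g],
   and for delta - theta the pairing is forced to vanish, so [g] is fixed. *)
have ipb : 0 <= ip (w (- nu, 1)).1 g.
  have := aff_ip wA (- nu, 1) (- theta, 2); rewrite wg /= => ->.
  by rewrite ipNl ipNr opprK ipC theta_ip.
exists nu, (areflect (w (- nu, 1)) \o w).
have wE' := elt_add wE nuP nJ erefl bS; case: (bS) ipb => [[i bE]|bE] ipb.
  have ngi : g != sroot i.
    apply/eqP => e; have : w (- nu, 1) = w (- theta, 2) by rewrite bE wg e.
    move=> /(can_inj wK) /(congr1 snd) /= /eqP.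
    by rewrite -subr_eq0 (_ : 1 - 2 = - 1 :> R) ?oppr_eq0 ?oner_eq0 //; lra.
  exists (refl ip (sroot i) g); split=> //.
    by rewrite /= wg bE /areflect /= mul0r subr0.
  split; first exact: refl_sroot_pos.
  move=> k; rewrite /refl !coefE coef_sroot gerBl mulr_ge0 ?ler0n //.
  rewrite /cartan divr_ge0 ?mulr_ge0 ?ip_ge0 ?ler0n //.
  by move: ipb; rewrite bE ipC.
have g0 : ip g theta = 0.
  have := theta_ip gP; move: ipb; rewrite bE /= ipNl (ipC g); lra.
exists g; split=> //; last by split=> //; exact: rlexx.
by rewrite /= wg bE /areflect /= reflN cartanNr /refl /cartan g0
  !(mulr0, mul0r, scale0r, oppr0, subr0).
Qed.

(** The missing roots of [K] are added one by one. This also produces the Peterson element of [K],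
    whose existence is not assumed. *)
Lemma rootlet_mono J K w g : abelian K -> J `<=` K -> elt J w ->
  w (- theta, 2) = (g, 0) -> pos g ->
  exists w' g', [/\ elt K w', w' (- theta, 2) = (g', 0), pos g' & rle g' g].
Proof.
move=> Kab; have [k] := ubnP (count (fun h => `[< K h /\ ~ J h >]) (undup Delta)).
elim: k J w g => // k IH J w g; rewrite ltnS => Jk JK wE wg gP.
have [<-|nJK] := pselect (J = K); first by exists w, g; split.
have [nu [w1 [g1 [Knu nJ w1E w1g [g1P g1g]]]]] := ideal_add Kab JK nJK wE wg gP.
have [|||||w' [g' [w'E w'g g'P g'g]]] // := IH (J `|` [set nu]) w1 g1.
- have [KP _ _] := Kab; apply: leq_trans Jk; rewrite -!size_filter.
  apply: (@uniq_leq_size _ (nu :: _)) => [|h].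
    rewrite /= filter_uniq ?undup_uniq // andbT mem_filter.
    by apply/negP => /andP[/asboolP[_ h] _]; apply: h; right.
  rewrite inE !mem_filter !mem_undup => /predU1P[->|/andP[/asboolP[Kh nh] hD]].
    by rewrite (pos_root (KP _ Knu)) andbT; apply/asboolP.
  by rewrite hD andbT; apply/asboolP; split=> // Jh; apply: nh; left.
- by move=> h [/JK//|->].
by exists w', g'; split=> //; exact: rle_trans g'g g1g.
Qed.

Lemma elt_theta : elt [set theta] (areflect (- theta, 1)) /\
  areflect (- theta, 1) (- theta, 2) = (theta, 0).
Proof.
have aS : asimple (- theta, 1) by right.
have aR := asimple_root aS; have aP := asimple_apos aS; have tD := theta_root.
have aa := areflect_self aR.1.
split.
  split=> [|x]; first exact: areflect_weyl.
  split=> [[xP nP]|[g /= -> ->]]; last by rewrite aa opprK.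
  exists theta => //; apply: contrapT => /(asimple_refl_apos aS xP) rP.
  exact: (aposN rP).
rewrite /areflect /= reflN cartanNr /refl /cartan ipNl.
have -> : 2 * - ip theta theta / ip theta theta = - 2.
  by rewrite mulrN mulNr mulfK // gt_eqF // root_ip.
congr pair; last by lra.
by rewrite scaleNr opprK scaler_nat mulr2n addrA addNr add0r.
Qed.

(** * Ideals, rootlets and amazing roots as defined in the statement *)

Lemma abelianE J : abelian_ideal Delta Pi J <-> abelian J.
Proof.
split=> [[[JP Jup] Jab]|[JP Jup Jab]].
  have JP' : allpos J by move=> g /JP /posrootE.
  split=> // [g h Jg hP gh|g h Jg Jh].
    apply: (Jup g) => //; first exact/posrootE.
    by apply/root_leE => //; [exact/pos_qlat/JP'|exact: pos_qlat].
  apply/negP => ghD; apply: (Jab g h Jg Jh); apply/posrootE.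
  by apply: pos_add => //; exact: JP'.
split; first split=> [g /JP /posrootE//|g h Jg /posrootE hP /root_leE gh].
  by apply: (Jup g) => //; apply: gh; [exact/pos_qlat/JP|exact: pos_qlat].
by move=> g h Jg Jh /posrootE[ghD _]; move: (Jab g h Jg Jh); rewrite ghD.
Qed.

Lemma ideal_geE g x : pos g -> ideal_ge Delta Pi g x <-> pos x /\ rle g x.
Proof.
move=> gP; split=> [[/posrootE xP /root_leE gx]|[xP gx]].
  by split=> //; apply: gx; exact: pos_qlat.
by split; [exact/posrootE|apply/root_leE => //; exact: pos_qlat].
Qed.

Lemma long_posrootE g : long_posroot ip Delta Pi g <-> pos g /\ long g.
Proof. by split=> -[/posrootE gP gL]; split=> //; apply/posrootE. Qed.

(** No Peterson element is required of [I]: the junk value [id] lies in the group as well. *)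
Lemma ideal_elt_weyl I : affine_weyl (ideal_elt ip Delta Pi I).
Proof.
rewrite /ideal_elt; set P := [set w | _].
have [->|nid] := pselect (@the (A -> A)%type id P = id); first exact: affine_weyl_id.
have PE := theP nid.
by have [] : P (@the (A -> A)%type id P) by rewrite {1}PE.
Qed.

Hypothesis thetaE : highest_root Delta Pi = theta.

(** The junk value [id] would leave 2 delta - theta at level 2, so a rootlet at level 0 certifies
    the description. *)
Lemma rootletP I g : rootlet ip Delta Pi I = (g, 0) ->
  elt I (ideal_elt ip Delta Pi I) /\ ideal_elt ip Delta Pi I (- theta, 2) = (g, 0).
Proof.
rewrite /rootlet thetaE => Ig; split=> //; apply/eltE.
move: Ig; rewrite /ideal_elt; set P := [set w | _] => Pg.
have nid : @the (A -> A)%type id P <> id.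
  by move=> e; move: Pg; rewrite e => -[_ /eqP]; rewrite pnatr_eq0.
have PE := theP nid.
by have : P (@the (A -> A)%type id P) by rewrite {1}PE.
Qed.

Lemma elt_rootlet I w g : elt I w -> w (- theta, 2) = (g, 0) ->
  rootlet ip Delta Pi I = (g, 0).
Proof. by move=> wE wg; rewrite /rootlet thetaE (ideal_elt_eq wE). Qed.

Notation fiber := (ideals_with_rootlet ip Delta Pi).

(** [Delta] is finite, so [J] extends to a maximal element of the fiber, which can only be [M]. *)
Lemma fiber_max_sub g M J : maximal_elements (@subset V) (fiber g) = [set M] ->
  fiber g J -> J `<=` M.
Proof.
move=> ME; have [k] := ubnP (count (fun h => `[< ~ J h >]) (undup Delta)).
elim: k J => // k IH J; rewrite ltnS => Jk JF.
have [[K [KF JK nJK]]|nK] := pselect (exists K, [/\ fiber g K, J `<=` K & K <> J]).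
  suff Kk : (count (fun h => `[< ~ K h >]) (undup Delta) < k)%N.
    by move=> h /JK; exact: IH Kk KF h.
  apply: leq_trans Jk.
  have [[[KP _] _] _ _] := KF.
  have [h [Kh nJh]] : exists h, K h /\ ~ J h.
    apply: contrapT => nh; apply: nJK; apply/seteqP; split=> // h Kh.
    by apply: contrapT => nJh; apply: nh; exists h.
  rewrite -!size_filter; apply: (@uniq_leq_size _ (h :: _)) => [|x].
    rewrite /= filter_uniq ?undup_uniq // andbT mem_filter.
    by apply/negP => /andP[/asboolP].
  rewrite inE !mem_filter !mem_undup => /predU1P[->|/andP[/asboolP nKx ->]].
    by have [-> _] := KP _ Kh; rewrite andbT; apply/asboolP.
  by rewrite andbT; apply/asboolP => /JK.
have : maximal_elements (@subset V) (fiber g) J.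
  split=> // K KF JK; apply: contrapT => nJK; apply: nK; exists K; split=> //.
by rewrite ME => ->.
Qed.

(** [ideal_ge] of [g] contains [g], hence is not the junk value [set0] of [ideal_max]; it is
    therefore a genuine largest member of the fiber. *)
Lemma amazingP g : amazing ip Delta Pi g -> [/\ pos g, long g, abelian (ideal_ge Delta Pi g),
  rootlet ip Delta Pi (ideal_ge Delta Pi g) = (g, 0) &
  forall J, fiber g J -> J `<=` ideal_ge Delta Pi g].
Proof.
move=> [/long_posrootE[gP gL] gE].
have gI : ideal_ge Delta Pi g g by apply/ideal_geE => //; split=> //; exact: rlexx.
move: gE; rewrite /ideal_max; set P := maximal_elements _ _ => gE.
have nP : the set0 P <> set0 by rewrite gE => e; rewrite e in gI.
have PE := theP nP.
rewrite gE in PE; have : P (ideal_ge Delta Pi g) by rewrite {1}PE.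
move=> [[/abelianE Iab _ Irt] _]; split=> // J; exact: fiber_max_sub PE.
Qed.

Lemma amazing_intro g : pos g -> long g -> abelian (ideal_ge Delta Pi g) ->
  rootlet ip Delta Pi (ideal_ge Delta Pi g) = (g, 0) ->
  (forall J, fiber g J -> J `<=` ideal_ge Delta Pi g) -> amazing ip Delta Pi g.
Proof.
move=> gP gL Iab Irt Imax; split; first exact/long_posrootE.
have gF : fiber g (ideal_ge Delta Pi g).
  split=> //; first exact/abelianE.
  by exists g; apply/ideal_geE => //; split=> //; exact: rlexx.
apply: theE; apply/seteqP; split=> [J [JF Jmax]|J ->] /=.
  by apply/esym/Jmax => //; exact: Imax.
by split=> // K KF IK; apply/seteqP; split=> //; exact: Imax.
Qed.

Lemma veeE g1 g2 nu : pos g1 -> pos g2 -> pos nu -> rle g1 nu -> rle g2 nu ->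
  (forall x, pos x -> rle g1 x -> rle g2 x -> rle nu x) -> vee Delta Pi g1 g2 = nu.
Proof.
move=> g1P g2P nuP n1 n2 nu_min.
have leE x y : pos x -> pos y -> root_le Pi x y <-> rle x y.
  by move=> xP yP; apply: root_leE; exact: pos_qlat.
apply: theE; apply/seteqP; split=> [x [[/posrootE xP h1 h2] xmin]|x ->] /=.
  move/(leE _ _ g1P xP): h1 => h1; move/(leE _ _ g2P xP): h2 => h2.
  by apply/esym/xmin; [split; [exact/posrootE|exact/leE|exact/leE]|apply/leE => //; exact: nu_min].
split; first by split; [exact/posrootE|exact/leE|exact/leE].
move=> y [/posrootE yP h1 h2] /(leE _ _ yP nuP) yn; apply: rle_anti => //.
by apply: nu_min => //; exact/leE.
Qed.

Lemma amazing_vee g1 g2 : amazing ip Delta Pi g1 -> amazing ip Delta Pi g2 ->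
  amazing ip Delta Pi (vee Delta Pi g1 g2).
Proof.
move=> /amazingP[g1P g1L ab1 rt1 max1] /amazingP[g2P g2L ab2 rt2 max2].
have [nu [nuP n1 n2 nu_min]] := join_ex g1P g2P.
have nuL := join_long g1P g2P g1L g2L nuP n1 n2 nu_min.
rewrite (veeE g1P g2P nuP n1 n2 nu_min).
set I := ideal_ge Delta Pi nu.
have sub1 : I `<=` ideal_ge Delta Pi g1.
  by move=> x /(ideal_geE _ nuP)[xP nx]; apply/ideal_geE => //; split=> //; exact: rle_trans nx.
have sub2 : I `<=` ideal_ge Delta Pi g2.
  by move=> x /(ideal_geE _ nuP)[xP nx]; apply/ideal_geE => //; split=> //; exact: rle_trans nx.
have Iab : abelian I.
  split=> [x /(ideal_geE _ nuP)[]//|x y /(ideal_geE _ nuP)[xP nx] yP xy|x y /sub1 Ix /sub1 Iy].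
    by apply/ideal_geE => //; split=> //; exact: rle_trans xy.
  by have [_ _] := ab1; apply.
have in_fiber J w g : J !=set0 -> elt J w -> allpos J -> w (- theta, 2) = (g, 0) -> fiber g J.
  move=> J0 wE JP wg; split=> //; first exact/abelianE/(elt_abelian wE).
  exact: elt_rootlet wE wg.
have fiber_sub J w : J !=set0 -> elt J w -> allpos J -> w (- theta, 2) = (nu, 0) -> J `<=` I.
  move=> [h Jh] wE JP wnu x Jx.
  have down g : pos g -> long g -> rle g nu ->
      (forall J, fiber g J -> J `<=` ideal_ge Delta Pi g) -> rle g x.
    move=> gP gL gn gmax.
    have [J' [w' [JJ' w'E J'P w'g]]] := rootlet_down nuP nuL gP gL gn wE JP wnu.
    have J'F : fiber g J' by apply: in_fiber w'E J'P w'g; exists h; exact: JJ'.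
    by have /(ideal_geE _ gP)[] := gmax _ J'F x (JJ' x Jx).
  by apply/ideal_geE => //; split; [exact: JP|apply: nu_min; [exact: JP|exact: down|exact: down]].
have [tE trt] := elt_theta.
have tP : allpos [set theta] by move=> x ->.
have [J0 [w0 [tJ0 w0E J0P w0nu]]] :=
  rootlet_down thetaP theta_long nuP nuL (theta_max nuP) tE tP trt.
have J0I : J0 `<=` I by apply: fiber_sub w0E J0P w0nu; exists theta; exact: tJ0.
have [w [mu [wE wmu muP mu_nu]]] := rootlet_mono Iab J0I w0E w0nu nuP.
(* Growing [I] to [ideal_ge] of [g] gives a rootlet below [mu]; uniqueness of the Peterson element
   identifies that rootlet with [g]. *)
have above g : abelian (ideal_ge Delta Pi g) -> I `<=` ideal_ge Delta Pi g ->
    rootlet ip Delta Pi (ideal_ge Delta Pi g) = (g, 0) -> rle g mu.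
  move=> gab Ig /rootletP[wgE wgg].
  have [w' [g' [w'E w'g _ g'mu]]] := rootlet_mono gab Ig wE wmu muP.
  have e := elt_uniq w'E wgE; rewrite e wgg in w'g.
  by case: w'g g'mu => <-.
have muE : mu = nu.
  by apply: rle_anti => //; apply: nu_min => //; exact: above.
apply: amazing_intro => //; first by apply: elt_rootlet wE _; rewrite wmu muE.
move=> J [/abelianE[JP _ _] J1 /rootletP[wJ wJnu]]; exact: fiber_sub wJ JP wJnu.
Qed.

End Roots.

Theorem lemma2p1 (R : realType) (V : vectType R) (ip : {dot V for @idfun R})
    (Delta Pi : seq V) (gamma1 gamma2 : V) :
  is_root_system ip Delta ->
  irreducible ip Delta ->
  is_base Delta Pi ->
  amazing ip Delta Pi gamma1 ->
  amazing ip Delta Pi gamma2 ->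
  amazing ip Delta Pi (vee Delta Pi gamma1 gamma2).
Proof.
move=> rootsD _ baseP am1 am2.
(* A junk highest root [0] would make every rootlet [(0, 2)], as [w] fixes
   [delta]. *)
have nh : highest_root Delta Pi <> 0.
  move=> h0; have [_ gE] := am1.
  have gI : ideal_ge Delta Pi gamma1 gamma1.
    have [[gP _] _] := am1; split=> //; apply/(root_leE baseP).
    - by apply: (root_qlat baseP); case: gP.
    - by apply: (root_qlat baseP); case: gP.
    - exact: rlexx.
  move: gE; rewrite /ideal_max; set P := maximal_elements _ _ => gE.
  have nP : the set0 P <> set0 by rewrite gE => e; rewrite e in gI.
have PE := theP nP.
  have : P (the set0 P) by rewrite {1}PE.
  move=> [[_ _]]; rewrite /rootlet h0 oppr0.
  rewrite (aff_delta (weyl_aff rootsD (ideal_elt_weyl _ _ _ _))) => -[_ /eqP].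
  by rewrite pnatr_eq0.
have hE := theP nh.
have : [set theta | posroot Delta Pi theta /\
    forall gamma, posroot Delta Pi gamma -> root_le Pi gamma theta] (highest_root Delta Pi).
  by rewrite {1}hE.
move=> [/(posrootE baseP) tP tmax].
apply: (amazing_vee rootsD baseP tP _ erefl am1 am2) => x xP.
apply/(root_leE baseP); [exact: (pos_qlat baseP)|exact: (pos_qlat baseP)|].
exact/tmax/(posrootE baseP).
Qed.
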